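(* Let $P$ be a regular convex $n$-gon with vertices $A_0,\dots,A_{n-1}$ (indices mod $n$), let $l$ be the line perpendicular to the plane of $P$ through its center, and let $O_0\ne O_1$ be points of $l$ not lying in the plane of $P$. Let $\mathcal D$ be the dipyramid with vertices $O_0,O_1$, and let $f\colon\mathcal D\to\mathbb{R}$ be convex on every simplex $O_0O_1A_kA_{k+1}$, $k=0,\dots,n-1$. Then $$\operatorname{Avg}(f,\mathcal D)\le\tfrac14f(O_0)+\tfrac34\operatorname{Avg}(f,\mathcal U_{O_1}),\qquad \operatorname{Avg}(f,\mathcal D)\le\tfrac14f(O_1)+\tfrac34\operatorname{Avg}(f,\mathcal U_{O_0}),$$ $$\operatorname{Avg}(f,h_{O_0}^{3/4}(\mathcal U_{O_1}))\le\operatorname{Avg}(f,\mathcal D),\qquad \operatorname{Avg}(f,h_{O_1}^{3/4}(\mathcal U_{O_0}))\le\operatorname{Avg}(f,\mathcal D),$$ $$\operatorname{Avg}(f,\mathcal D)\le\tfrac12\left(\operatorname{Avg}(f,O_0O_1)+\operatorname{Avg}(f,\partial P)\right),\qquad \operatorname{Avg}(f,\mathcal D)\le\tfrac12\left(\operatorname{Avg}(f,\mathcal S_{O_0})+\operatorname{Avg}(f,\mathcal S_{O_1})\right).$$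
   Context: For a point $X\in l$, the Chinese umbrella with vertex $X$ is $\mathcal U_X=\bigcup_{k=0}^{n-1}\operatorname{conv}\{X,A_k,A_{k+1}\}$ and its scaffold is $\mathcal S_X=\bigcup_{k=0}^{n-1}XA_k$ (union of segments). The dipyramid with vertices $O_0,O_1$ is the body bounded by $\mathcal U_{O_0}$ and $\mathcal U_{O_1}$, i.e. $\mathcal D=\bigcup_{k=0}^{n-1}\operatorname{conv}\{O_0,O_1,A_k,A_{k+1}\}$ (it need not be convex). $\partial P$ is the boundary polygonal line of $P$. $\operatorname{Avg}(f,\mathcal D)$ is the average with respect to volume, averages over umbrellas are with respect to surface area, and averages over segments, $\partial P$ and scaffolds are with respect to length. $h_{\mathbf a}^\lambda(\mathbf x)=\mathbf a+\lambda(\mathbf x-\mathbf a)$. *)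

(* Defs.v *)
From HB Require Import structures.
From mathcomp Require Import all_boot all_order all_algebra.
From mathcomp Require Import all_classical all_reals all_analysis.
Set Implicit Arguments. Unset Strict Implicit. Unset Printing Implicit Defensive.
Import Order.TTheory GRing.Theory Num.Theory.
Import numFieldNormedType.Exports.
Local Open Scope classical_set_scope.
Local Open Scope ring_scope.

Section Geometry.
Variable R : realType.

Definition pt := 'rV[R]_3.

Definition dotp (u v : pt) : R := (u *m v^T) 0 0.

Definition vlen (u : pt) : R := Num.sqrt (dotp u u).

Definition seg_len (a b : pt) : R := vlen (b - a).
Definition tri_area (a b c : pt) : R :=
  let u := b - a in let v := c - a in
  Num.sqrt (dotp u u * dotp v v - dotp u v ^+ 2) / 2.
Definition tet_vol (a b c d : pt) : R :=
  `| \det (col_mx (b - a) (col_mx (c - a) (d - a))) | / 6.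

Definition homothety (a : pt) (lam : R) (x : pt) : pt := a + lam *: (x - a).

Definition std1 : set R := [set t | 0 <= t <= 1].
Definition std2 : set (R * R) := [set p | 0 <= p.1 /\ 0 <= p.2 /\ p.1 + p.2 <= 1].
Definition std3 : set (R * R * R) :=
  [set p | 0 <= p.1.1 /\ 0 <= p.1.2 /\ 0 <= p.2 /\ p.1.1 + p.1.2 + p.2 <= 1].

Definition leb := (@lebesgue_measure R).
Definition leb2 := (leb \x leb)%E.
Definition leb3 := (leb2 \x leb)%E.

(** Averages with respect to length / area / volume over a single segment,
    triangle, tetrahedron: the affine parametrization of the simplex by the
    standard simplex has constant Jacobian, so the uniform average is the
    normalized Lebesgue integral over the standard simplex. *)
Definition avg_seg (f : pt -> R) (a b : pt) : R :=
  Rintegral leb std1 (fun t => f (a + t *: (b - a))).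
Definition avg_tri (f : pt -> R) (a b c : pt) : R :=
  2 * Rintegral leb2 std2 (fun p => f (a + p.1 *: (b - a) + p.2 *: (c - a))).
Definition avg_tet (f : pt -> R) (a b c d : pt) : R :=
  6 * Rintegral leb3 std3
    (fun p => f (a + p.1.1 *: (b - a) + p.1.2 *: (c - a) + p.2 *: (d - a))).

(** Average over a finite union of simplices with pairwise (measure-)disjoint
    interiors: weighted mean of the piecewise averages, weights = measures. *)
Definition wavg (n : nat) (w : nat -> R) (av : nat -> R) : R :=
  (\sum_(k < n) w k * av k) / (\sum_(k < n) w k).

(** Regular n-gon: A k = C + r cos(th0 + 2 pi k/n) e1 + r sin(th0 + 2 pi k/n) e2,
    with e1, e2 orthonormal; indices are automatically taken mod n. *)
Definition reg_vertex (n : nat) (C e1 e2 : pt) (r th0 : R) (k : nat) : pt :=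
  let th := th0 + 2 * pi * k%:R / n%:R in
  C + (r * cos th) *: e1 + (r * sin th) *: e2.

Definition avg_dipyramid (f : pt -> R) (n : nat) (A : nat -> pt) (O0 O1 : pt) : R :=
  wavg n (fun k => tet_vol O0 O1 (A k) (A k.+1))
         (fun k => avg_tet f O0 O1 (A k) (A k.+1)).

(** Avg(f, g(U_X)) for the image of the Chinese umbrella U_X under an affine map g
    (used with g = id and g = a homothety). *)
Definition avg_umbrella_img (g : pt -> pt) (f : pt -> R) (n : nat) (A : nat -> pt) (X : pt) : R :=
  wavg n (fun k => tri_area (g X) (g (A k)) (g (A k.+1)))
         (fun k => avg_tri f (g X) (g (A k)) (g (A k.+1))).
Definition avg_umbrella f n A X := avg_umbrella_img id f n A X.

Definition avg_scaffold (f : pt -> R) (n : nat) (A : nat -> pt) (X : pt) : R :=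
  wavg n (fun k => seg_len X (A k)) (fun k => avg_seg f X (A k)).

Definition avg_boundary (f : pt -> R) (n : nat) (A : nat -> pt) : R :=
  wavg n (fun k => seg_len (A k) (A k.+1)) (fun k => avg_seg f (A k) (A k.+1)).

Definition conv4 (a b c d : pt) : set pt :=
  [set x | exists l0 l1 l2 l3 : R, [/\ 0 <= l0, 0 <= l1, 0 <= l2 & 0 <= l3] /\
      l0 + l1 + l2 + l3 = 1 /\ x = l0 *: a + l1 *: b + l2 *: c + l3 *: d].

Definition convex_on (S : set pt) (f : pt -> R) : Prop :=
  forall x y t, S x -> S y -> 0 <= t <= 1 ->
    f ((1 - t) *: x + t *: y) <= (1 - t) * f x + t * f y.

End Geometry.

(* Main.v *)
(* On each simplex [O0 O1 A_k A_(k+1)] the uniform measure disintegrates in two ways: over the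
   slices parallel to a face, homothetic copies of it weighted by [3 s^2] where [s] is the ratio
   of the homothety; and as a join of two opposite edges, [x = (1 - t) u + t v] with [u] and [v]
   uniform on the edges and [t] of density [6 t (1 - t)].  Bounding [f] by convexity along the
   segments from the apex to the face (mean of [s] is [3/4]), applying Jensen's inequality to the
   averages over the slices, and bounding [f] by convexity along the segments [uv] give the three
   kinds of inequalities on a simplex.  The last one applies to each of the three pairs of opposite
   edges.  By symmetry of the polygon, all the simplices, faces and edges involved have weights
   independent of [k], and these are nonzero, so it only remains to sum over [k].
   Measurability comes for free: a convex function on a simplex is upper semicontinuous. *)

Require Import Defs.
From HB Require Import structures.
From mathcomp Require Import all_boot all_order all_algebra.
From mathcomp Require Import all_classical all_reals all_analysis.
From mathcomp Require Import measurable_realfun ring lra.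
Set Implicit Arguments.
Unset Strict Implicit.
Unset Printing Implicit Defensive.
Import Order.TTheory GRing.Theory Num.Theory.
Import numFieldNormedType.Exports.
Local Open Scope classical_set_scope.
Local Open Scope ring_scope.

(** * Affine substitutions and iterated integrals *)

Section AffineSubstitution.
Variable R : realType.
Local Notation mu := (@lebesgue_measure R).
Local Open Scope ereal_scope.

Lemma measurable_affine (c b : R) :
  measurable_fun setT (fun x : R => (c * x + b)%R).
Proof. by apply: measurable_funD => //; exact: measurable_realfun.measurable_funM. Qed.

(** By uniqueness of Lebesgue measure: [c] times its pushforward under [x |-> c x + b] gives each
    half-open interval its length. *)
Lemma ge0_integral_affine (c b : R) (h : R -> \bar R) : (0 < c)%R ->
  measurable_fun setT h -> (forall x, 0 <= h x) ->
  \int[mu]_x h x = c%:E * \int[mu]_x h (c * x + b)%R.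
Proof.
move=> c0 mh h0.
pose phi : measurableTypeR R -> measurableTypeR R := fun x => (c * x + b)%R.
have mphi : measurable_fun setT phi := measurable_affine c b.
pose k : {nonneg R} := NngNum (ltW c0).
pose nu0 : {measure set (measurableTypeR R) -> \bar R} := mscale k (pushforward mu phi).
pose nu := nu0 mphi.
have E A : measurable A -> mu A = nu A.
  apply: lebesgue_measure_unique => _ [[p q] /= _] <-.
  rewrite /nu /mscale /= /mscale /pushforward /=.
  have -> : phi @^-1` `]p, q] = `]((p - b) / c)%R, ((q - b) / c)%R]%classic.
    apply/seteqP; split => x /=; rewrite /phi !in_itv /= ltr_pdivrMr // ler_pdivlMr //; lra.
  rewrite !lebesgue_measure_itv /= !lte_fin ltr_pM2r ?invr_gt0 // ltrD2r.
  case: ifP => _; last by rewrite mule0.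
  rewrite -!EFinD -EFinM; congr EFin; field.
  by rewrite gt_eqF.
transitivity (\int[nu]_x h x).
  by apply: eq_measure_integral => A mA _; exact: E.
rewrite /nu /nu0 ge0_integral_mscale //; congr (_ * _).
by rewrite (ge0_integral_pushforward mphi) // => ? _.
Qed.

Lemma ge0_integral_reflect (b : R) (h : R -> \bar R) :
  measurable_fun setT h -> (forall x, 0 <= h x) ->
  \int[mu]_x h x = \int[mu]_x h (b - x)%R.
Proof.
move=> mh h0.
transitivity (\int[pushforward mu (-%R : _ -> measurableTypeR R)]_x h x).
  by apply: eq_measure_integral => A mA _; exact/esym/lebesgue_measureN.
rewrite ge0_integral_pushforward //.
rewrite preimage_setT [RHS](@ge0_integral_affine 1 b%R) //; last first.
  apply: (measurableT_comp mh).
  by apply: measurable_funB => //; exact: measurable_cst.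
by rewrite mul1e; apply: eq_integral => x _ /=; congr h; lra.
Qed.

End AffineSubstitution.

Ltac measurable_poly :=
  repeat first
    [ exact: measurable_cst | exact: measurable_id | exact: measurable_fst
    | exact: measurable_snd
    | exact: (measurableT_comp measurable_fst measurable_fst)
    | exact: (measurableT_comp measurable_snd measurable_fst)
    | exact: (measurableT_comp measurable_fst measurable_snd)
    | exact: (measurableT_comp measurable_snd measurable_snd)
    | apply: measurable_fun_pair
    | apply: measurable_funB | apply: measurable_funD | apply: measurable_funM ].

(* The sigma-finiteness of a product measure is shadowed by the canonical
   instances for products of (sub)probabilities, hence redone for [leb2] *)
Lemma leb2_sigma_finite (R : realType) : sigma_finite setT (@leb2 R).
Proof.
have /sigma_finiteP[F [TF ndF Foo]] := sigma_finiteT (@lebesgue_measure R).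
exists (fun n => F n `*` F n).
  rewrite -setXTT TF predeqE => -[x y]; split.
    move=> [/= [n _ Fnx] [k _ Fky]]; exists (maxn n k) => //; split.
    - by move: x Fnx; exact/subsetPset/ndF/leq_maxl.
    - by move: y Fky; exact/subsetPset/ndF/leq_maxr.
  by move=> [n _ []/= ? ?]; split; exists n.
move=> k; have [? ?] := Foo k; split; first exact: measurableX.
by rewrite /leb2 product_measure1E// lte_mul_pinfty// ge0_fin_numE.
Qed.

HB.instance Definition _ (R : realType) := Measure.on (@leb2 R).
HB.instance Definition _ (R : realType) :=
  Measure_isSigmaFinite.Build _ _ _ (@leb2 R) (@leb2_sigma_finite R).
HB.instance Definition _ (R : realType) := Measure.on (@leb3 R).

Section Tonelli.
Variable R : realType.
Local Notation mu := (@lebesgue_measure R).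
Local Open Scope ereal_scope.

Lemma leb2_tonelli (H : R * R -> \bar R) :
  measurable_fun setT H -> (forall p, 0 <= H p) ->
  \int[@leb2 R]_p H p = \int[mu]_y \int[mu]_x H (x, y).
Proof. by move=> mH H0; rewrite /leb2 /leb fubini_tonelli2. Qed.

Lemma tonelli_swap (H : R -> R -> \bar R) :
  measurable_fun setT (fun p : R * R => H p.1 p.2) ->
  (forall x y, 0 <= H x y) ->
  \int[mu]_x \int[mu]_y H x y = \int[mu]_y \int[mu]_x H x y.
Proof.
by move=> mH H0; apply: (@fubini_tonelli _ _ _ _ _ mu mu _ mH) => p; exact: H0.
Qed.

Lemma measurable_partial_integral d (T : measurableType d) (H : T -> R -> \bar R) :
  measurable_fun setT (fun p : T * R => H p.1 p.2) ->
  (forall x y, 0 <= H x y) ->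
  measurable_fun setT (fun x => \int[mu]_y H x y).
Proof.
move=> mH H0.
by apply: (@measurable_fun_fubini_tonelli_F _ _ _ _ _ mu _ mH) => p; exact: H0.
Qed.

Lemma leb3_tonelli (G : R * R * R -> \bar R) :
  measurable_fun setT G -> (forall p, 0 <= G p) ->
  \int[@leb3 R]_p G p = \int[mu]_z \int[mu]_y \int[mu]_x G (x, y, z).
Proof.
move=> mG G0.
rewrite (@fubini_tonelli2 _ _ _ _ _ (@leb2 R) mu G mG G0).
apply: eq_integral => z _; rewrite /fubini_G.
apply: (leb2_tonelli (H := fun p => G (p, z))) => //.
exact: (measurable_fun_pair1 (f := G)).
Qed.

Lemma leb3_swap12 (G : R * R * R -> \bar R) :
  measurable_fun setT G -> (forall p, 0 <= G p) ->
  \int[@leb3 R]_p G p = \int[@leb3 R]_p G (p.1.2, p.1.1, p.2).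
Proof.
move=> mG G0; rewrite [RHS]leb3_tonelli; last 2 first.
- by apply: (measurableT_comp mG); measurable_poly.
- by move=> p; exact: G0.
rewrite [LHS](leb3_tonelli mG G0).
apply: eq_integral => z _.
apply: (tonelli_swap (H := fun y x => G (x, y, z))) => [|x y]; last exact: G0.
by apply: (measurableT_comp mG); measurable_poly.
Qed.

Lemma leb3_swap23 (G : R * R * R -> \bar R) :
  measurable_fun setT G -> (forall p, 0 <= G p) ->
  \int[@leb3 R]_p G p = \int[@leb3 R]_p G (p.1.1, p.2, p.1.2).
Proof.
move=> mG G0; rewrite [RHS]leb3_tonelli; last 2 first.
- by apply: (measurableT_comp mG); measurable_poly.
- by move=> p; exact: G0.
rewrite [LHS](leb3_tonelli mG G0).
apply: (tonelli_swap (H := fun z y => \int[mu]_x G (x, y, z))); last first.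
  by move=> x y; apply: integral_ge0 => z _; exact: G0.
apply: (measurable_partial_integral (H := fun p x => G (x, p.2, p.1))) => [|x y].
- by apply: (measurableT_comp mG); measurable_poly.
- exact: G0.
Qed.

(** This involution exchanges the vertices [(0, 0, 0)] and [(1, 0, 0)] of the standard simplex and
    fixes the other two. With the two coordinate swaps it generates all permutations of the
    vertices. *)
Lemma leb3_reflect (G : R * R * R -> \bar R) :
  measurable_fun setT G -> (forall p, 0 <= G p) ->
  \int[@leb3 R]_p G p = \int[@leb3 R]_p G (1 - p.1.1 - p.1.2 - p.2, p.1.2, p.2)%R.
Proof.
move=> mG G0; rewrite [RHS]leb3_tonelli; last 2 first.
- by apply: (measurableT_comp mG); measurable_poly.
- by move=> p; exact: G0.
rewrite [LHS](leb3_tonelli mG G0).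
apply: eq_integral => z _; apply: eq_integral => y _.
rewrite [LHS](ge0_integral_reflect (1 - y - z)%R); last 2 first.
- by apply: (measurableT_comp mG); measurable_poly.
- by move=> x; exact: G0.
by apply: eq_integral => x _; congr (G (_, _, _)); rewrite /=; lra.
Qed.

Lemma leb2_scale (c : R) (H : R * R -> \bar R) : (0 < c)%R ->
  measurable_fun setT H -> (forall p, 0 <= H p) ->
  \int[@leb2 R]_p H p = (c ^+ 2)%:E * \int[@leb2 R]_p H (c * p.1, c * p.2)%R.
Proof.
move=> c0 mH H0; rewrite [X in _ * X]leb2_tonelli; last 2 first.
- by apply: (measurableT_comp mH); measurable_poly.
- by move=> p; exact: H0.
rewrite [LHS](leb2_tonelli mH H0) [LHS](ge0_integral_affine 0 c0); last 2 first.
- apply: (measurable_partial_integral (H := fun y x => H (x, y))) => //.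
  by apply: (measurableT_comp mH); measurable_poly.
- by move=> y; exact: integral_ge0.
rewrite expr2 EFinM -muleA; congr (_ * _).
rewrite -ge0_integralZl_EFin; last 4 first.
- exact: measurableT.
- by move=> y _; exact: integral_ge0.
- apply: (measurable_partial_integral (H := fun y x => H (c * x, c * y)%R)) => //.
  by apply: (measurableT_comp mH); measurable_poly.
- exact: ltW.
apply: eq_integral => y _; rewrite [LHS](ge0_integral_affine 0 c0); last 2 first.
- by apply: (measurableT_comp mH); measurable_poly.
- by move=> x; exact: H0.
by rewrite addr0; congr (_ * _); apply: eq_integral => x _; rewrite addr0.
Qed.

End Tonelli.

(** * Disintegration of the standard simplex *)

Section Disintegration.
Variable R : realType.
Local Notation mu := (@lebesgue_measure R).
Local Open Scope ereal_scope.

Lemma std1E : @std1 R = `[0%R, 1%R]%classic.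
Proof. by apply/seteqP; split => x /=; rewrite in_itv. Qed.

(** The endpoints carry no mass, and on the open interval the scaling factors [1 - z], [t] and
    [1 - t] used below are positive. *)
Lemma integral_supp01 (h : R -> \bar R) : measurable_fun setT h ->
  (forall x, ~ @std1 R x -> h x = 0) ->
  \int[mu]_x h x = \int[mu]_(x in `]0%R, 1%R[) h x.
Proof.
move=> mh h0; rewrite -(integral_itv_bndoo true false); last exact: measurable_funTS.
rewrite [RHS]integral_mkcond; apply: eq_integral => x _.
by rewrite patchE -std1E; case: ifPn => // /negP; rewrite inE => /h0.
Qed.

Lemma integral_suppE d (T : measurableType d) (m : {measure set T -> \bar R})
    (D : set T) (h : T -> \bar R) :
  (forall x, ~ D x -> h x = 0) -> \int[m]_x h x = \int[m]_(x in D) h x.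
Proof.
move=> h0; rewrite [RHS]integral_mkcond; apply: eq_integral => x _.
by rewrite patchE; case: ifPn => // /negP; rewrite inE => /h0.
Qed.

Lemma measurable_std1 : measurable (@std1 R).
Proof. by rewrite std1E; exact: measurable_itv. Qed.

Lemma measurable_integral_in d (T : measurableType d) d' (U : measurableType d')
    (m : {sigma_finite_measure set U -> \bar R}%R) (D : set U) (H : T -> U -> \bar R) :
  measurable D -> measurable_fun setT (fun p : T * U => H p.1 p.2) ->
  (forall x y, 0 <= H x y) ->
  measurable_fun setT (fun x => \int[m]_(y in D) H x y).
Proof.
move=> mD mH H0.
pose K := (fun p : T * U => H p.1 p.2) \_ (setT `*` D).
have mK : measurable_fun setT K.
  by apply/(measurable_restrictT _ (measurableX measurableT mD)); exact: measurable_funTS.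
have K0 p : 0 <= K p by apply: erestrict_ge0 => ? _; exact: H0.
have -> : (fun x => \int[m]_(y in D) H x y) = fubini_F m K.
  apply/funext => x; rewrite integral_mkcond; apply: eq_integral => y _.
  rewrite /K !patchE; congr (if _ then _ else _).
  by apply/idP/idP => /[!inE]; [split|case].
exact: measurable_fun_fubini_tonelli_F.
Qed.

Variable G : R * R * R -> \bar R.
Hypotheses (mG : measurable_fun setT G) (G0 : forall p, 0 <= G p).
Hypothesis suppG : forall p, ~ @std3 R p -> G p = 0.

(** The slice at height [z] is the standard triangle scaled by [1 - z], and rescaling it produces
    the factor [(1 - z)^2]. *)
Lemma leb3_cone : \int[@leb3 R]_p G p =
  \int[mu]_(z in `]0%R, 1%R[) (((1 - z) ^+ 2)%:E *
    \int[@leb2 R]_(q in @std2 R) G ((1 - z) * q.1, (1 - z) * q.2, z)%R).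
Proof.
rewrite (@fubini_tonelli2 _ _ _ _ _ (@leb2 R) mu G mG G0) integral_supp01; first last.
- move=> z nz; apply: integral0_eq => -[x y] _; apply: suppG => -[/= x0 [y0 [z0 s1]]].
  by apply: nz; rewrite /std1 /=; lra.
- exact: measurable_fun_fubini_tonelli_G.
apply: eq_integral => z; rewrite inE /= in_itv /= => /andP[z0 z1].
have c0 : (0 < 1 - z)%R by lra.
rewrite /fubini_G (leb2_scale c0); last 2 first.
- exact: measurable_fun_pair1.
- by move=> p; exact: G0.
congr (_ * _); apply: integral_suppE => -[x y] /= nq; apply: suppG => -[/= x0 [y0 [_ s1]]].
apply: nq; rewrite /std2 /=.
move: x0 y0; rewrite !pmulr_rge0 // => x0 y0; split=> //; split=> //.
by rewrite -(ler_pM2l c0) mulr1; lra.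
Qed.

(** The simplex is the join of the edge from [(0, 0, 0)] to [(1, 0, 0)], with parameter [u], and the
    edge from [(0, 1, 0)] to [(0, 0, 1)], with parameter [v]. The substitutions [y = t - z],
    [z = t v] and [x = (1 - t) u] have total Jacobian [t (1 - t)]. *)
Lemma leb3_join : \int[@leb3 R]_p G p =
  \int[mu]_(t in `]0%R, 1%R[) ((t * (1 - t))%:E *
    \int[mu]_(v in @std1 R) \int[mu]_(u in @std1 R)
       G ((1 - t) * u, t * (1 - v), t * v)%R).
Proof.
pose Phi y z := \int[mu]_x G (x, y, z).
have Phi0 y z : 0 <= Phi y z by apply: integral_ge0 => x _; exact: G0.
have mPhi : measurable_fun setT (fun p => Phi p.1 p.2).
  apply: (measurable_partial_integral (H := fun p x => G (x, p.1, p.2))) => [|x y].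
  - by apply: (measurableT_comp mG); measurable_poly.
  - exact: G0.
(* At fixed [z], the variable [y] is replaced by [t = y + z]. *)
have shear z : \int[mu]_y Phi y z = \int[mu]_t Phi (t - z)%R z.
  rewrite [LHS](ge0_integral_affine (- z) (ltr01)); last 2 first.
  - apply: (measurableT_comp mPhi (g := fun y => (y, z))); measurable_poly.
  - by move=> y; exact: Phi0.
  by rewrite mul1e; apply: eq_integral => t _; rewrite mul1r.
have mPhi' : measurable_fun setT (fun p : R * R => Phi (p.1 - p.2)%R p.2).
  by apply: (measurableT_comp mPhi (g := fun p : R * R => (p.1 - p.2, p.2)%R)); measurable_poly.
rewrite [LHS](leb3_tonelli mG G0).
under eq_integral => z _ do rewrite -/(Phi _ z) shear.
(* With [t] outermost, the factors [t] and [1 - t] are constants in the two rescalings that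
   follow. *)
rewrite (tonelli_swap (H := fun z t => Phi (t - z)%R z)); last 2 first.
- by apply: (measurableT_comp mPhi (g := fun p : R * R => (p.2 - p.1, p.1)%R)); measurable_poly.
- by move=> x y; exact: Phi0.
rewrite integral_supp01; first last.
- move=> t nt; apply: integral0_eq => z _; apply: integral0_eq => x _.
  apply: suppG => -[/= x0 [y0 [z0 s1]]].
  by apply: nt; rewrite /std1 /=; lra.
- exact: (@measurable_partial_integral R _ R (fun t z => Phi (t - z)%R z) mPhi'
    (fun x y => Phi0 _ _)).
apply: eq_integral => t; rewrite inE /= in_itv /= => /andP[t0 t1].
have c0 : (0 < 1 - t)%R by lra.
rewrite [LHS](ge0_integral_affine 0 t0); last 2 first.
- by apply: (measurableT_comp mPhi (g := fun z : R => (t - z, z)%R)); measurable_poly.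
- by move=> x; exact: Phi0.
rewrite EFinM -muleA; congr (_ * _).
rewrite -ge0_integralZl_EFin; last 4 first.
- by rewrite std1E; exact: measurable_itv.
- by move=> v _; apply: integral_ge0 => u _; exact: G0.
- apply: measurable_funTS.
  apply: (@measurable_integral_in _ R _ _ mu _
    (fun v u => G ((1 - t) * u, t * (1 - v), t * v)%R) measurable_std1) => [|v u].
  + by apply: (measurableT_comp mG); measurable_poly.
  + exact: G0.
- exact: ltW.
rewrite (@integral_suppE _ _ mu (@std1 R)); last first.
  move=> v nv; apply: integral0_eq => x _; apply: suppG => -[/= x0 [y0 [z0 s1]]].
  apply: nv; rewrite /std1 /=; move: y0 z0; rewrite addr0 pmulr_rge0 // => y0 ->/=.
  by rewrite -(ler_pM2l t0); lra.
apply: eq_integral => v; rewrite inE => v01.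
rewrite addr0 /Phi [LHS](ge0_integral_affine 0 c0); last 2 first.
- by apply: (measurableT_comp mG); measurable_poly.
- by move=> x; exact: G0.
congr (_ * _); rewrite (@integral_suppE _ _ mu (@std1 R)); last first.
  move=> u nu; apply: suppG => -[/= x0 [y0 [z0 s1]]].
  apply: nu; rewrite /std1 /=; move: x0; rewrite addr0 pmulr_rge0 // => ->/=.
  by rewrite -(ler_pM2l c0); lra.
apply: eq_integral => u _; congr (G (_, _, _)); rewrite /=; lra.
Qed.

End Disintegration.

(** * Integrability of bounded functions *)

Section BoundedIntegrable.
Context d (T : measurableType d) (R : realType) (m : {measure set T -> \bar R}).

Lemma integrable_of_bounded (D : set T) (h : T -> R) (M : R) :
  measurable D -> (m D < +oo)%E -> measurable_fun D h ->
  (forall x, D x -> `|h x| <= M) -> m.-integrable D (EFin \o h).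
Proof.
move=> mD fD mh hM; apply: measurable_bounded_integrable => //.
exists M; split; first exact: num_real.
by move=> y My x Dx; exact: le_trans (hM x Dx) (ltW My).
Qed.

Lemma EFin_Rintegral (D : set T) (h : T -> R) :
  measurable D -> m.-integrable D (EFin \o h) ->
  (Rintegral m D h)%:E = (\int[m]_(x in D) (h x)%:E)%E.
Proof. by move=> mD ih; rewrite /Rintegral fineK // integrable_fin_num. Qed.

Lemma measurable_nonneg (h : T -> R) :
  measurable_fun setT h -> measurable [set x | 0 <= h x].
Proof.
move=> mh; rewrite -(setTI [set x | _]).
rewrite (_ : [set x | 0 <= h x] = h @^-1` `[0, +oo[%classic); last first.
  by apply/seteqP; split => x /=; rewrite in_itv /= andbT.
by apply: mh => //; exact: measurable_itv.
Qed.

End BoundedIntegrable.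

(** * Standard simplices: measurability, moments and volumes *)

Section Simplices.
Variable R : realType.
Local Notation mu := (@lebesgue_measure R).

Lemma mu_std1 : mu (@std1 R) = 1%E.
Proof. by rewrite std1E lebesgue_measure_itv /= lte_fin ltr01 -EFinD subr0. Qed.

Lemma measurable_std2 : measurable (@std2 R).
Proof.
rewrite (_ : std2 (R := R) = [set p | 0 <= p.1] `&`
    ([set p | 0 <= p.2] `&` [set p | 0 <= 1 - (p.1 + p.2)])).
  apply: measurableI; last apply: measurableI; apply: measurable_nonneg; measurable_poly.
by apply/seteqP; split => p /=; rewrite subr_ge0.
Qed.

Lemma measurable_std3 : measurable (@std3 R).
Proof.
rewrite (_ : std3 (R := R) = [set p | 0 <= p.1.1] `&` ([set p | 0 <= p.1.2] `&`
    ([set p | 0 <= p.2] `&` [set p | 0 <= 1 - (p.1.1 + p.1.2 + p.2)]))).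
  apply: measurableI; last (apply: measurableI; last apply: measurableI);
  apply: measurable_nonneg; measurable_poly.
by apply/seteqP; split => p /=; rewrite subr_ge0.
Qed.

Lemma continuous_integrable01 (h : R -> R) : continuous h ->
  mu.-integrable `[0, 1]%classic (EFin \o h).
Proof.
move=> ch; apply: continuous_compact_integrable; first exact: segment_compact.
exact: continuous_subspaceT.
Qed.

(** The moment of [(1 - z)^n] is [1 / (n + 1)]. All bounds on slices and joins, once multiplied by
    their density, are cubics in [1 - z] without constant term. *)
Lemma Rintegral01_poly (a b c : R) :
  Rintegral mu `]0, 1[%classic
    (fun z => a * (1 - z) + b * (1 - z) ^+ 2 + c * (1 - z) ^+ 3) =
  a / 2 + b / 3 + c / 4.
Proof.
have cX n : continuous (fun z : R => (1 - z) ^+ n).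
  by move=> x; exact: continuous_onemXn.
have iX (k : R) n : mu.-integrable `[0, 1]%classic (EFin \o (fun z => k * (1 - z) ^+ n)).
  by apply: continuous_integrable01 => x; apply: cvgMr; exact: cX.
rewrite /Rintegral -(integral_itv_bndoo true false); last first.
  by apply/measurable_EFinP; measurable_poly.
rewrite -/(Rintegral _ _ _).
have m1 : measurable (`[0, 1]%classic : set R) by exact: measurable_itv.
under eq_Rintegral => z _ do rewrite -{1}(expr1 (1 - z)).
rewrite RintegralD //; last first.
  by apply: continuous_integrable01 => x; apply: cvgD; apply: cvgMr; exact: cX.
rewrite RintegralD //.
have mom n : Rintegral mu `[0, 1]%classic (fun z => (1 - z) ^+ n) = n.+1%:R^-1.
  exact: Rintegral_onemXn.
rewrite !RintegralZl //; try exact: continuous_integrable01 (cX _).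
by rewrite !mom.
Qed.

End Simplices.

Section Volumes.
Variable R : realType.
Local Notation mu := (@lebesgue_measure R).

Lemma integrable01_poly (a b c : R) :
  mu.-integrable `]0, 1[%classic
    (EFin \o (fun z => a * (1 - z) + b * (1 - z) ^+ 2 + c * (1 - z) ^+ 3)).
Proof.
apply: (@integrable_of_bounded _ _ _ _ _ _ (`|a| + `|b| + `|c|)).
- exact: measurable_itv.
- by rewrite /= lebesgue_measure_itv /= lte_fin ltr01 -EFinD ltry.
- by apply: measurable_funTS; measurable_poly.
move=> z /=; rewrite in_itv /= => /andP[z0 z1].
have le1 n : `|(1 - z) ^+ n| <= 1.
  by rewrite normrX exprn_ile1 // ger0_norm; lra.
have leM (k : R) n : `|k * (1 - z) ^+ n| <= `|k| by rewrite normrM ler_piMr.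
apply: (le_trans (ler_normD _ _)); apply: lerD; last exact: leM.
apply: (le_trans (ler_normD _ _)); apply: lerD; last exact: leM.
exact: (leM a 1).
Qed.

Lemma EFin_integral01_poly (a b c : R) :
  (\int[mu]_(z in `]0%R, 1%R[)
     (a * (1 - z) + b * (1 - z) ^+ 2 + c * (1 - z) ^+ 3)%:E)%E =
  (a / 2 + b / 3 + c / 4)%:E.
Proof.
rewrite -Rintegral01_poly EFin_Rintegral //; exact: integrable01_poly.
Qed.

(** By Tonelli, since the section at height [y] is the interval [[0, 1 - y]]. *)
Lemma leb2_std2 : @leb2 R (@std2 R) = (1 / 2)%:E.
Proof.
have m2 := @measurable_std2 R.
have mI : measurable_fun setT (EFin \o (\1_(@std2 R) : R * R -> R)).
  by apply/measurable_EFinP; exact: measurable_indic.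
have I0 p : (0 <= (EFin \o (\1_(@std2 R) : R * R -> R)) p)%E.
  by rewrite lee_fin.
rewrite -(setIT (@std2 R)) -(integral_indic (@leb2 R) measurableT m2).
rewrite [LHS](leb2_tonelli mI I0) integral_supp01; first last.
- move=> y ny; apply: integral0_eq => x _ /=; rewrite indicE memNset //=.
  by move=> -[/= x0 [y0 s1]]; apply: ny; rewrite /std1 /=; lra.
- apply: (@measurable_integral_in _ _ R _ _ mu setT
    (fun y x => (EFin \o (\1_(@std2 R) : R * R -> R)) (x, y))) => //.
  by apply: (measurableT_comp mI (g := fun p : R * R => (p.2, p.1))); measurable_poly.
transitivity (\int[mu]_(z in `]0%R, 1%R[)
     (1 * (1 - z) + 0 * (1 - z) ^+ 2 + 0 * (1 - z) ^+ 3)%:E)%E.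
  apply: eq_integral => y; rewrite inE /= in_itv /= => /andP[y0 y1].
  transitivity (\int[mu]_x (\1_(`[0, 1 - y]%classic) x)%:E)%E.
    apply: eq_integral => x _; rewrite /= !indicE.
    suff -> : ((x, y) \in @std2 R) = (x \in `[0, 1 - y]%classic) by [].
    apply/idP/idP; rewrite !inE /std2 /= in_itv /=; first by case=> ? [? ?]; lra.
    by move=> /andP[? ?]; split=> //; split; lra.
  rewrite integral_indic; [|exact: measurableT|exact: measurable_itv].
  by rewrite setIT [LHS]lebesgue_measure_itv /= lte_fin subr_gt0 y1 -EFinD; congr EFin; lra.
by rewrite [LHS]EFin_integral01_poly; congr EFin; lra.
Qed.

(** The cone formula for the indicator function: the slice at height [z] contributes
    [(1 - z)^2 / 2]. *)
Lemma leb3_std3 : @leb3 R (@std3 R) = (1 / 6)%:E.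
Proof.
have m3 := @measurable_std3 R.
have mI : measurable_fun setT (EFin \o (\1_(@std3 R) : R * R * R -> R)).
  by apply/measurable_EFinP; exact: measurable_indic.
have I0 p : (0 <= (EFin \o (\1_(@std3 R) : R * R * R -> R)) p)%E.
  by rewrite lee_fin.
rewrite -(setIT (@std3 R)) -(integral_indic (@leb3 R) measurableT m3).
rewrite [LHS](leb3_cone mI I0); last by move=> p np /=; rewrite indicE memNset.
transitivity (\int[mu]_(z in `]0%R, 1%R[)
     (0 * (1 - z) + (1 / 2) * (1 - z) ^+ 2 + 0 * (1 - z) ^+ 3)%:E)%E.
  apply: eq_integral => z; rewrite inE /= in_itv /= => /andP[z0 z1].
  rewrite (_ : (_ + _) + _ = (1 - z) ^+ 2 * (1 / 2))%R; last by ring.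
  rewrite [RHS]EFinM; congr (mule _ _); rewrite -leb2_std2.
  transitivity (\int[@leb2 R]_(q in @std2 R) (1%:E))%E.
    apply: eq_integral => -[x y]; rewrite inE => -[/= x0 [y0 s1]].
    rewrite indicE mem_set //=; have c0 : 0 <= 1 - z by lra.
    have [xz yz] : 0 <= (1 - z) * x /\ 0 <= (1 - z) * y by split; exact: mulr_ge0.
    rewrite /std3 /=; do 3 (split; first lra).
    by rewrite -mulrDr; have := ler_wpM2l c0 s1; lra.
  by rewrite integral_cst ?mul1e //; exact: measurable_std2.
by rewrite [LHS]EFin_integral01_poly; congr EFin; lra.
Qed.

End Volumes.

Section RealDisintegration.
Variable R : realType.
Local Notation mu := (@lebesgue_measure R).

Lemma integrable_std1 (h : R -> R) (M : R) :
  measurable_fun setT h -> (forall x, `|h x| <= M) ->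
  mu.-integrable (@std1 R) (EFin \o h).
Proof.
move=> mh hM; apply: (@integrable_of_bounded _ _ _ _ _ _ M); last by move=> x Dx; exact: hM.
- exact: measurable_std1.
- by rewrite /= mu_std1 ltry.
- exact: measurable_funTS.
Qed.

Lemma integrable_itv01 (h : R -> R) (M : R) :
  measurable_fun setT h -> (forall x, `]0, 1[%classic x -> `|h x| <= M) ->
  mu.-integrable `]0, 1[%classic (EFin \o h).
Proof.
move=> mh hM; apply: (@integrable_of_bounded _ _ _ _ _ _ M); last by move=> x Dx; exact: hM.
- exact: measurable_itv.
- by rewrite /= lebesgue_measure_itv /= lte_fin ltr01 -EFinD ltry.
- exact: measurable_funTS.
Qed.

Lemma integrable_std2 (h : R * R -> R) (M : R) :
  measurable_fun setT h -> (forall x, `|h x| <= M) ->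
  (@leb2 R).-integrable (@std2 R) (EFin \o h).
Proof.
move=> mh hM; apply: (@integrable_of_bounded _ _ _ _ _ _ M); last by move=> x Dx; exact: hM.
- exact: measurable_std2.
- by change (@leb2 R (@std2 R) < +oo)%E; rewrite leb2_std2 ltry.
- exact: measurable_funTS.
Qed.

Lemma integrable_std3 (h : R * R * R -> R) (M : R) :
  measurable_fun setT h -> (forall x, `|h x| <= M) ->
  (@leb3 R).-integrable (@std3 R) (EFin \o h).
Proof.
move=> mh hM; apply: (@integrable_of_bounded _ _ _ _ _ _ M); last by move=> x Dx; exact: hM.
- exact: measurable_std3.
- by change (@leb3 R (@std3 R) < +oo)%E; rewrite leb3_std3 ltry.
- exact: measurable_funTS.
Qed.

End RealDisintegration.

(** * Inequalities on the standard simplex *)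

(** Take for [m] the supremum of the slopes of the chords arriving at [c] from the left: it is at
    most every slope of a chord leaving [c] to the right. *)
Lemma exists_subgradient (R : realType) (phi : R -> R) (a c b : R) :
  a < c < b ->
  (forall x y t, a <= x <= b -> a <= y <= b -> 0 <= t <= 1 ->
    phi ((1 - t) * x + t * y) <= (1 - t) * phi x + t * phi y) ->
  exists m, forall x, a <= x <= b -> phi c + m * (x - c) <= phi x.
Proof.
move=> /andP[ac cb] cvx.
have slopes s x : a <= s < c -> c < x <= b ->
    (phi c - phi s) / (c - s) <= (phi x - phi c) / (x - c).
  move=> /andP[as_ sc] /andP[cx xb].
  have sx : 0 < x - s by lra.
  (* This weight on [x] makes the convex combination of [s] and [x] equal to [c]. *)
  have := cvx s x ((c - s) / (x - s)).
  rewrite (_ : (1 - (c - s) / (x - s)) * s + (c - s) / (x - s) * x = c); last first.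
    by field; rewrite gt_eqF.
  rewrite divr_ge0 /=; [|lra|lra]; rewrite ler_pdivrMr // mul1r => H.
  have {}H := H ltac:(lra) ltac:(lra) ltac:(lra).
  rewrite ler_pdivrMr; last lra.
  rewrite mulrAC ler_pdivlMr; last lra.
  have E : (x - s) * ((1 - (c - s) / (x - s)) * phi s + (c - s) / (x - s) * phi x)
     = (x - c) * phi s + (c - s) * phi x by field; rewrite gt_eqF.
  by have := ler_wpM2l (ltW sx) H; rewrite E; nra.
pose S := [set (phi c - phi s) / (c - s) | s in [set s | a <= s < c]].
have Sa : S ((phi c - phi a) / (c - a)) by exists a => //=; rewrite lexx.
have ubS x : c < x <= b -> ubound S ((phi x - phi c) / (x - c)).
  by move=> cx _ [s /= sc <-]; exact: slopes.
have hsS : has_sup S.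
  split; first by exists ((phi c - phi a) / (c - a)).
  by exists ((phi b - phi c) / (b - c)); apply: ubS; rewrite cb lexx.
exists (sup S) => x /andP[ax xb].
have [xc|cx|->] := ltgtP x c; last by rewrite subrr mulr0 addr0.
- have : (phi c - phi x) / (c - x) <= sup S.
    by apply: ub_le_sup; [exact: hsS.2|exists x => //=; rewrite ax].
  by rewrite ler_pdivrMr; [lra|lra].
- have : sup S <= (phi x - phi c) / (x - c).
    by apply: ge_sup; [exists ((phi c - phi a) / (c - a))|apply: ubS; rewrite cx].
  by rewrite ler_pdivlMr; [lra|lra].
Qed.

Section SimplexInequalities.
Variable R : realType.
Local Notation mu := (@lebesgue_measure R).
Variables (g : R * R * R -> R) (M : R).
Hypotheses (mg : measurable_fun setT g) (g0 : forall p, 0 <= g p).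
Hypotheses (gM : forall p, g p <= M) (suppg : forall p, ~ @std3 R p -> g p = 0).
Hypothesis cg : forall p q t, @std3 R p -> @std3 R q -> 0 <= t <= 1 ->
  g ((1 - t) * p.1.1 + t * q.1.1, (1 - t) * p.1.2 + t * q.1.2, (1 - t) * p.2 + t * q.2)
  <= (1 - t) * g p + t * g q.

Let normg p : `|g p| <= M. Proof. by rewrite ger0_norm. Qed.
Let M0 : 0 <= M := le_trans (g0 (0, 0, 0)) (gM _).
Let mG : measurable_fun setT (EFin \o g). Proof. exact/measurable_EFinP. Qed.
Let G0 p : (0 <= (EFin \o g) p)%E. Proof. by rewrite lee_fin. Qed.
Let suppG p : ~ @std3 R p -> (EFin \o g) p = 0%E.
Proof. by move=> /suppg /= ->. Qed.

Let intE : (\int[@leb3 R]_p (EFin \o g) p)%E = (\int[@leb3 R]_(p in @std3 R) (g p)%:E)%E.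
Proof. exact: integral_suppE. Qed.

(** Half the mean of [g] over the slice at height [z], since the standard triangle has area [1 / 2].
    All slices are pulled back to the same triangle so that they can be compared pointwise. *)
Let phi z := Rintegral (@leb2 R) (@std2 R) (fun q => g ((1 - z) * q.1, (1 - z) * q.2, z)).

Let mslice z : measurable_fun setT (fun q : R * R => g ((1 - z) * q.1, (1 - z) * q.2, z)).
Proof. by apply: (measurableT_comp mg); measurable_poly. Qed.

Let islice z : (@leb2 R).-integrable (@std2 R)
  (EFin \o (fun q : R * R => g ((1 - z) * q.1, (1 - z) * q.2, z))).
Proof. by apply: integrable_std2 => [|x]; [exact: mslice|exact: normg]. Qed.

Let mphi : measurable_fun setT phi.
Proof.
apply: measurableT_comp; first exact: fine_measurable.
apply: (@measurable_integral_in _ _ R _ _ (@leb2 R) (@std2 R)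
  (fun z q => (g ((1 - z) * q.1, (1 - z) * q.2, z))%:E)).
- exact: measurable_std2.
- by apply/measurable_EFinP; apply: (measurableT_comp mg); measurable_poly.
- by move=> z q; exact: G0.
Qed.

Let Rint_cst_std2 (k : R) : Rintegral (@leb2 R) (@std2 R) (cst k) = k / 2.
Proof.
rewrite Rintegral_cst; last exact: measurable_std2.
by change (k * fine (@leb2 R (@std2 R)) = k / 2); rewrite leb2_std2 /= div1r.
Qed.

Let phi_bound z : `|phi z| <= M / 2.
Proof.
rewrite ger0_norm; last by apply: Rintegral_ge0 => q _; exact: g0.
rewrite -Rint_cst_std2; apply: le_Rintegral.
- exact: measurable_std2.
- exact: islice.
- by apply: (@integrable_std2 _ _ `|M|) => //; exact: measurable_cst.
- by move=> q _; exact: gM.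
Qed.

Lemma Rintegral_cone : Rintegral (@leb3 R) (@std3 R) g =
  Rintegral mu `]0, 1[%classic (fun z => (1 - z) ^+ 2 * phi z).
Proof.
rewrite /Rintegral -intE (leb3_cone mG G0 suppG); congr fine.
apply: eq_integral => z _; rewrite [RHS]EFinM; congr (mule _ _).
rewrite /phi EFin_Rintegral; [by []|exact: measurable_std2|exact: islice].
Qed.

Let iweighted : mu.-integrable `]0, 1[%classic (EFin \o (fun z => (1 - z) ^+ 2 * phi z)).
Proof.
apply: (@integrable_itv01 _ _ (M / 2)).
  by apply: measurable_funM; [measurable_poly|exact: mphi].
move=> z /=; rewrite in_itv /= => /andP[z0 z1].
rewrite normrM -[leRHS]mul1r; apply: ler_pM => //.
by rewrite normrX exprn_ile1 // ger0_norm; lra.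
Qed.

(** Convexity along the segments from the base to the apex [(0, 0, 1)] bounds [phi z] by an affine
    function of [z], which is then integrated against [(1 - z)^2]. *)
Lemma cone_average_le : 6 * Rintegral (@leb3 R) (@std3 R) g <=
  g (0, 0, 1) / 4 + 3 / 4 * (2 * Rintegral (@leb2 R) (@std2 R) (fun q => g (q.1, q.2, 0))).
Proof.
rewrite Rintegral_cone; set T := (X in 2 * X).
have mbase : measurable_fun setT (fun q : R * R => g (q.1, q.2, 0)).
  by apply: (measurableT_comp mg); measurable_poly.
have ibase : (@leb2 R).-integrable (@std2 R) (EFin \o (fun q => g (q.1, q.2, 0))).
  by apply: integrable_std2 => [|x]; [exact: mbase|exact: normg].
have phi_le z : 0 < z -> z < 1 -> phi z <= z * g (0, 0, 1) / 2 + (1 - z) * T.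
  move=> z0 z1.
  have ic : (@leb2 R).-integrable (@std2 R) (EFin \o (cst (z * g (0, 0, 1)))).
    by apply: (@integrable_std2 _ _ `|z * g (0, 0, 1)|) => //; exact: measurable_cst.
  have ib : (@leb2 R).-integrable (@std2 R) (EFin \o (fun q => (1 - z) * g (q.1, q.2, 0))).
    apply: (@integrable_std2 _ _ (`|1 - z| * M)) => [|x].
      by apply: measurable_funM; [exact: measurable_cst|exact: mbase].
    by rewrite normrM ler_wpM2l.
  have -> : z * g (0, 0, 1) / 2 + (1 - z) * T = Rintegral (@leb2 R) (@std2 R)
      (fun q => cst (z * g (0, 0, 1)) q + (1 - z) * g (q.1, q.2, 0)).
    rewrite RintegralD //; last exact: measurable_std2.
    by rewrite Rint_cst_std2 RintegralZl //; exact: measurable_std2.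
  apply: le_Rintegral.
  - exact: measurable_std2.
  - exact: islice.
  - apply: (@integrable_std2 _ _ (`|z * g (0, 0, 1)| + `|1 - z| * M)) => [|x].
      apply: measurable_funD; first exact: measurable_cst.
      by apply: measurable_funM; [exact: measurable_cst|exact: mbase].
    by apply: (le_trans (ler_normD _ _)); apply: lerD => //; rewrite normrM ler_wpM2l.
  move=> q [q1 [q2 q12]].
  have := @cg (q.1, q.2, 0) (0, 0, 1) z.
  rewrite /= !mulr0 !addr0 add0r mulr1 => H.
  rewrite [leRHS]addrC; apply: H; rewrite /std3 /=; try lra; by do ![split=> //]; lra.
pose k := g (0, 0, 1) / 2.
(* The bound on [phi z] reads [k + (T - k) (1 - z)]; times [(1 - z)^2], it has coefficients [0], [k]
   and [T - k]. *)
apply: (@le_trans _ _ (6 * (0 / 2 + k / 3 + (T - k) / 4))); last by rewrite /k; lra.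
rewrite ler_pM2l // -Rintegral01_poly; apply: le_Rintegral.
- exact: measurable_itv.
- exact: iweighted.
- exact: integrable01_poly.
move=> z /=; rewrite in_itv /= => /andP[z0 z1].
have z2 : 0 <= (1 - z) ^+ 2 by apply: sqr_ge0.
apply: le_trans (ler_wpM2l z2 (phi_le z z0 z1)) _.
rewrite [leLHS](_ : _ = 0 * (1 - z) + k * (1 - z) ^+ 2 + (T - k) * (1 - z) ^+ 3) //.
by rewrite /k; field.
Qed.

(* Jensen for the slice averages: under the density [3 (1 - z)^2] the height has mean [1/4] *)
Lemma slice_average_le :
  2 * Rintegral (@leb2 R) (@std2 R) (fun q => g (3 / 4 * q.1, 3 / 4 * q.2, 1 / 4)) <=
  6 * Rintegral (@leb3 R) (@std3 R) g.
Proof.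
have -> : Rintegral (@leb2 R) (@std2 R) (fun q => g (3 / 4 * q.1, 3 / 4 * q.2, 1 / 4)) =
    phi (1 / 4).
  by apply: eq_Rintegral => q _; rewrite (_ : 1 - 1 / 4 = 3 / 4) //; lra.
(* [phi] is convex because, at fixed [q], the point of the slice depends affinely on [z]; hence it
   has a supporting line at [1 / 4]. *)
have [m hm] : exists m, forall z, 0 <= z <= 1 -> phi (1 / 4) + m * (z - 1 / 4) <= phi z.
  apply: exists_subgradient; first by apply/andP; split; lra.
  move=> z w t /andP[z0 z1] /andP[w0 w1] /andP[t0 t1].
  have iz (k x : R) : (@leb2 R).-integrable (@std2 R)
      (EFin \o (fun q => k * g ((1 - x) * q.1, (1 - x) * q.2, x))).
    apply: (@integrable_std2 _ _ (`|k| * M)) => [|y]; last by rewrite normrM ler_wpM2l.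
    by apply: measurable_funM; [exact: measurable_cst|exact: mslice].
  have m2 := @measurable_std2 R.
  rewrite /phi -(RintegralZl (1 - t) _ (islice z)) // -(RintegralZl t _ (islice w)) //.
  rewrite -(RintegralD _ (iz _ _) (iz _ _)) //; apply: le_Rintegral => //.
  - apply: (@integrable_std2 _ _ (`|1 - t| * M + `|t| * M)) => [|y].
      by apply: measurable_funD; apply: measurable_funM; try exact: measurable_cst; exact: mslice.
    by apply: (le_trans (ler_normD _ _)); apply: lerD; rewrite normrM ler_wpM2l.
  move=> q [q1 [q2 q12]].
  have mem x : 0 <= x -> x <= 1 -> @std3 R ((1 - x) * q.1, (1 - x) * q.2, x).
    move=> x0 x1; have c0 : 0 <= 1 - x by lra.
    have [? ?] : 0 <= (1 - x) * q.1 /\ 0 <= (1 - x) * q.2 by split; exact: mulr_ge0.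
    rewrite /std3 /=; do 3 (split => //).
    by rewrite -mulrDr; have := ler_wpM2l c0 q12; lra.
  have := @cg _ _ t (mem z z0 z1) (mem w w0 w1); rewrite t0 t1 /= => /(_ isT).
  apply: le_trans; rewrite le_eqVlt; apply/orP; left; apply/eqP; congr (g (_, _, _)); ring.
rewrite Rintegral_cone.
(* The supporting line is [phi (1 / 4) + 3 / 4 m - m (1 - z)], and its two terms in [m] cancel after
   integration. *)
apply: (@le_trans _ _ (6 * (0 / 2 + (phi (1 / 4) + 3 / 4 * m) / 3 + (- m) / 4))); first by lra.
rewrite ler_pM2l // -Rintegral01_poly; apply: le_Rintegral.
- exact: measurable_itv.
- exact: integrable01_poly.
- exact: iweighted.
move=> z /=; rewrite in_itv /= => /andP[z0 z1].
have z2 : 0 <= (1 - z) ^+ 2 by apply: sqr_ge0.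
have z01 : 0 <= z <= 1 by rewrite !ltW.
apply: le_trans (ler_wpM2l z2 (hm z z01)).
by rewrite [leLHS](_ : _ = (1 - z) ^+ 2 * (phi (1 / 4) + m * (z - 1 / 4))) //; field.
Qed.

(** Averages over [u], then over [v], at a fixed position [t] between the two edges; no normalizing
    factor occurs since [std1] has length one. *)
Let inner t v := Rintegral mu (@std1 R) (fun u => g ((1 - t) * u, t * (1 - v), t * v)).
Let outer t := Rintegral mu (@std1 R) (inner t).

Let iinner t v : mu.-integrable (@std1 R)
  (EFin \o (fun u => g ((1 - t) * u, t * (1 - v), t * v))).
Proof.
apply: integrable_std1 => [|x]; last exact: normg.
by apply: (measurableT_comp mg); measurable_poly.
Qed.

Let Rint_cst_std1 (k : R) : Rintegral mu (@std1 R) (cst k) = k.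
Proof.
rewrite Rintegral_cst; last exact: measurable_std1.
by change (k * fine (mu (@std1 R)) = k); rewrite mu_std1 /= mulr1.
Qed.

Let icst (k : R) : mu.-integrable (@std1 R) (EFin \o cst k).
Proof. by apply: (@integrable_std1 _ _ `|k|) => //; exact: measurable_cst. Qed.

Let inner_bound t v : `|inner t v| <= M.
Proof.
rewrite ger0_norm; last by apply: Rintegral_ge0 => q _; exact: g0.
rewrite -[leRHS]Rint_cst_std1; apply: le_Rintegral.
- exact: measurable_std1.
- exact: iinner.
- exact: icst.
- by move=> q _; exact: gM.
Qed.

Let minner : measurable_fun setT (fun p : R * R => inner p.1 p.2).
Proof.
apply: measurableT_comp; first exact: fine_measurable.
apply: (@measurable_integral_in _ _ (R * R)%type _ _ mu (@std1 R)
  (fun p u => (g ((1 - p.1) * u, p.1 * (1 - p.2), p.1 * p.2))%:E)).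
- exact: measurable_std1.
- by apply/measurable_EFinP; apply: (measurableT_comp mg); measurable_poly.
- by move=> z q; exact: G0.
Qed.

Let minner1 t : measurable_fun setT (inner t).
Proof. by apply: (measurableT_comp minner (g := fun v => (t, v))); measurable_poly. Qed.

Let iinner1 t : mu.-integrable (@std1 R) (EFin \o inner t).
Proof. by apply: integrable_std1 => [|x]; [exact: minner1|exact: inner_bound]. Qed.

Let outer_bound t : `|outer t| <= M.
Proof.
rewrite ger0_norm; last first.
  by apply: Rintegral_ge0 => v _; apply: Rintegral_ge0 => q _; exact: g0.
rewrite -[leRHS]Rint_cst_std1; apply: le_Rintegral.
- exact: measurable_std1.
- exact: iinner1.
- exact: icst.
- by move=> v _; exact: le_trans (ler_norm _) (inner_bound t v).
Qed.

Let mouter : measurable_fun setT outer.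
Proof.
apply: measurableT_comp; first exact: fine_measurable.
apply: (@measurable_integral_in _ _ R _ _ mu (@std1 R) (fun t v => (inner t v)%:E)).
- exact: measurable_std1.
- by apply/measurable_EFinP; exact: minner.
- by move=> t v; rewrite lee_fin; apply: Rintegral_ge0 => q _; exact: g0.
Qed.

Lemma Rintegral_join : Rintegral (@leb3 R) (@std3 R) g =
  Rintegral mu `]0, 1[%classic (fun t => t * (1 - t) * outer t).
Proof.
rewrite /Rintegral -intE (leb3_join mG G0 suppG); congr fine.
apply: eq_integral => t _; rewrite [RHS]EFinM; congr (mule _ _).
rewrite /outer EFin_Rintegral; [|exact: measurable_std1|exact: iinner1].
apply: eq_integral => v _.
by rewrite /inner EFin_Rintegral; [|exact: measurable_std1|exact: iinner].
Qed.

(** Convexity along the segments joining the two edges gives a bound affine in [t]. The density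
    [t (1 - t)] is symmetric, so both edges receive the same share. *)
Lemma opposite_edges_average_le : 6 * Rintegral (@leb3 R) (@std3 R) g <=
  (Rintegral mu (@std1 R) (fun u => g (u, 0, 0)) +
   Rintegral mu (@std1 R) (fun v => g (0, 1 - v, v))) / 2.
Proof.
rewrite Rintegral_join; set S1 := (X in X + _); set S2 := (X in _ + X).
have m1 := @measurable_std1 R.
have mab : measurable_fun setT (fun u : R => g (u, 0, 0)).
  by apply: (measurableT_comp mg); measurable_poly.
have mcd : measurable_fun setT (fun v : R => g (0, 1 - v, v)).
  by apply: (measurableT_comp mg); measurable_poly.
have iZ (k : R) (h : R -> R) : measurable_fun setT h -> (forall x, `|h x| <= M) ->
    mu.-integrable (@std1 R) (EFin \o (fun x => k * h x)).
  move=> mh hM; apply: (@integrable_std1 _ _ (`|k| * M)) => [|y]; last by rewrite normrM ler_wpM2l.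
  by apply: measurable_funM; [exact: measurable_cst|exact: mh].
have iab : mu.-integrable (@std1 R) (EFin \o (fun u => g (u, 0, 0))).
  by apply: (integrable_std1 mab) => x; exact: normg.
have icd : mu.-integrable (@std1 R) (EFin \o (fun v => g (0, 1 - v, v))).
  by apply: (integrable_std1 mcd) => x; exact: normg.
have inner_le t v : 0 < t -> t < 1 -> @std1 R v ->
    inner t v <= (1 - t) * S1 + t * g (0, 1 - v, v).
  move=> t0 t1 /andP[v0 v1].
  have -> : (1 - t) * S1 + t * g (0, 1 - v, v) = Rintegral mu (@std1 R)
      (fun u => (1 - t) * g (u, 0, 0) + cst (t * g (0, 1 - v, v)) u).
    rewrite RintegralD //; last by apply: iZ => // x; exact: normg.
    by rewrite Rint_cst_std1 RintegralZl.
  apply: le_Rintegral => //.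
    apply: (@integrable_std1 _ _ (`|1 - t| * M + `|t * g (0, 1 - v, v)|)) => [|y].
      apply: measurable_funD; last exact: measurable_cst.
      by apply: measurable_funM; [exact: measurable_cst|exact: mab].
    by apply: (le_trans (ler_normD _ _)); apply: lerD => //; rewrite normrM ler_wpM2l.
  move=> u /andP[u0 u1].
  have := @cg (u, 0, 0) (0, 1 - v, v) t; rewrite /= !mulr0 !add0r addr0 => H.
  apply: H; last by rewrite !ltW.
  - by rewrite /std3 /=; repeat split; lra.
  - by rewrite /std3 /=; repeat split; lra.
have outer_le t : 0 < t -> t < 1 -> outer t <= (1 - t) * S1 + t * S2.
  move=> t0 t1.
  have -> : (1 - t) * S1 + t * S2 = Rintegral mu (@std1 R)
      (fun v => cst ((1 - t) * S1) v + t * g (0, 1 - v, v)).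
    rewrite RintegralD //; last by apply: iZ => // x; exact: normg.
    by rewrite Rint_cst_std1 RintegralZl.
  apply: le_Rintegral => //; first exact: iinner1.
    apply: (@integrable_std1 _ _ (`|(1 - t) * S1| + `|t| * M)) => [|y].
      apply: measurable_funD; first exact: measurable_cst.
      by apply: measurable_funM; [exact: measurable_cst|exact: mcd].
    by apply: (le_trans (ler_normD _ _)); apply: lerD => //; rewrite normrM ler_wpM2l.
  by move=> v v01; exact: inner_le.
(* The coefficients are those of [t (1 - t) ((1 - t) S1 + t S2)] expanded in powers of [1 - t]. *)
apply: (@le_trans _ _ (6 * (S2 / 2 + (S1 - 2 * S2) / 3 + (S2 - S1) / 4))); last by lra.
rewrite ler_pM2l // -Rintegral01_poly; apply: le_Rintegral.
- exact: measurable_itv.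
- apply: (@integrable_itv01 _ _ M).
    by apply: measurable_funM; [measurable_poly|exact: mouter].
  move=> z /=; rewrite in_itv /= => /andP[z0 z1].
  rewrite normrM -[leRHS]mul1r; apply: ler_pM => //.
  by rewrite ger0_norm; nra.
- exact: integrable01_poly.
move=> t /=; rewrite in_itv /= => /andP[t0 t1].
have t2 : 0 <= t * (1 - t) by apply: mulr_ge0; lra.
apply: le_trans (ler_wpM2l t2 (outer_le t t0 t1)) _.
rewrite le_eqVlt; apply/orP; left; apply/eqP; ring.
Qed.

End SimplexInequalities.

(** * Regularity of convex functions on a simplex *)

Section ConvexOnSimplex.
Variables (R : realType) (h : R * R * R -> R).
Hypothesis ch : forall p q t, @std3 R p -> @std3 R q -> 0 <= t <= 1 ->
  h ((1 - t) * p.1.1 + t * q.1.1, (1 - t) * p.1.2 + t * q.1.2, (1 - t) * p.2 + t * q.2)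
  <= (1 - t) * h p + t * h q.

(** An upper bound at two points spreads to the segment between them; the coordinates are tied by
    equations so that they can be proved separately. *)
Let convex_le (K : R) p q t x y z : @std3 R p -> @std3 R q -> 0 <= t <= 1 ->
  h p <= K -> h q <= K ->
  x = (1 - t) * p.1.1 + t * q.1.1 -> y = (1 - t) * p.1.2 + t * q.1.2 ->
  z = (1 - t) * p.2 + t * q.2 -> h (x, y, z) <= K.
Proof.
move=> p3 q3 t01 hp hq -> -> ->; apply: le_trans (ch p3 q3 t01) _.
by move/andP: t01 => [t0 t1]; nra.
Qed.

Let std3P x y z : 0 <= x -> 0 <= y -> 0 <= z -> x + y + z <= 1 -> @std3 R (x, y, z).
Proof. by rewrite /std3 /=; do !split. Qed.

(** A bound at the vertices spreads to an edge, then to a face, then to the simplex, each being a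
    cone over the previous one. *)
Lemma convex_simplex_ubound : exists K, forall p, @std3 R p -> h p <= K.
Proof.
pose K := `|h (0, 0, 0)| + `|h (1, 0, 0)| + `|h (0, 1, 0)| + `|h (0, 0, 1)|.
have n0 p : 0 <= `|h p| by [].
have K0 : h (0, 0, 0) <= K.
  by apply: le_trans (ler_norm _) _; move: (n0 (1,0,0)) (n0 (0,1,0)) (n0 (0,0,1)); rewrite /K; lra.
have K1 : h (1, 0, 0) <= K.
  by apply: le_trans (ler_norm _) _; move: (n0 (0,0,0)) (n0 (0,1,0)) (n0 (0,0,1)); rewrite /K; lra.
have K2 : h (0, 1, 0) <= K.
  by apply: le_trans (ler_norm _) _; move: (n0 (1,0,0)) (n0 (0,0,0)) (n0 (0,0,1)); rewrite /K; lra.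
have K3 : h (0, 0, 1) <= K.
  by apply: le_trans (ler_norm _) _; move: (n0 (1,0,0)) (n0 (0,1,0)) (n0 (0,0,0)); rewrite /K; lra.
have edge x : 0 <= x <= 1 -> h (x, 0, 0) <= K.
  move=> x01; apply: (@convex_le K (0, 0, 0) (1, 0, 0) x) => //=; try lra.
  - by apply: std3P; lra.
  - by apply: std3P; lra.
have face x y : 0 <= x -> 0 <= y -> x + y <= 1 -> h (x, y, 0) <= K.
  move=> x0 y0 xy.
  (* The projection from [(0, 1, 0)] divides by [1 - y]; if [y = 1], the point is that vertex
     itself. *)
  have [y1|y1] := ltP y 1; last first.
    by have [-> ->] : x = 0 /\ y = 1 by split; lra.
  have c0 : 0 < 1 - y by lra.
  have x1 : 0 <= x / (1 - y) <= 1.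
    by apply/andP; split; [apply: divr_ge0|rewrite ler_pdivrMr //]; lra.
  apply: (@convex_le K (x / (1 - y), 0, 0) (0, 1, 0) y) => //=; try lra.
  - by apply: std3P; move/andP: x1 => []; lra.
  - by apply: std3P; lra.
  - exact: edge.
  - by rewrite mulr0 addr0 mulrC divfK // gt_eqF.
exists K => -[[x y] z] [/= x0 [y0 [z0 s1]]].
have [z1|z1] := ltP z 1; last first.
  by have [-> -> ->] : [/\ x = 0, y = 0 & z = 1] by split; lra.
have c0 : 0 < 1 - z by lra.
have x1 : 0 <= x / (1 - z) by apply: divr_ge0; lra.
have y1 : 0 <= y / (1 - z) by apply: divr_ge0; lra.
have xy1 : x / (1 - z) + y / (1 - z) <= 1 by rewrite -mulrDl ler_pdivrMr //; lra.
apply: (@convex_le K (x / (1 - z), y / (1 - z), 0) (0, 0, 1) z) => //=; try lra.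
- by apply: std3P; lra.
- by apply: std3P; lra.
- exact: face.
- by rewrite mulr0 addr0 mulrC divfK // gt_eqF.
- by rewrite mulr0 addr0 mulrC divfK // gt_eqF.
Qed.

(* every point of the simplex is joined to a point of the simplex through the barycenter *)
Lemma convex_simplex_lbound : exists N, forall p, @std3 R p -> N <= h p.
Proof.
have [K hK] := convex_simplex_ubound.
exists (4 * h (1 / 4, 1 / 4, 1 / 4) - 3 * K) => -[[x y] z] [/= x0 [y0 [z0 s1]]].
have p3 : @std3 R (x, y, z) by exact: std3P.
(* The barycenter is [1 / 4] of the given point plus [3 / 4] of this one. *)
have q3 : @std3 R ((1 - x) / 3, (1 - y) / 3, (1 - z) / 3) by apply: std3P; lra.
have t01 : 0 <= (3 / 4 : R) <= 1 by apply/andP; split; lra.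
have := ch p3 q3 t01; have := hK _ q3; rewrite /=.
rewrite (_ : ((1 - 3 / 4) * x + _, _, _) = (1 / 4, 1 / 4, 1 / 4)); last by congr (_, _, _); field.
lra.
Qed.

(* A convex function on a simplex is upper semicontinuous up to the boundary: a point [q] close
   to [p] is [(1 - e) p + e r] with [r] in the simplex. *)
Lemma convex_simplex_usc p c : @std3 R p -> h p < c ->
  exists2 d, 0 < d & forall q, @std3 R q -> `|q.1.1 - p.1.1| < d ->
    `|q.1.2 - p.1.2| < d -> `|q.2 - p.2| < d -> h q < c.
Proof.
have [K hK] := convex_simplex_ubound.
move: p => [[x y] z] p3 pc; have [/= x0 [y0 [z0 s1]]] := p3.
have hpK := hK _ p3; set P := h (x, y, z) in pc hpK.
(* Chosen so that the convexity bound [(1 - e) P + e K] stays below [c]; the added [1] ensures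
   [e < 1] even when [K = P]. *)
pose e := (c - P) / (c - P + (K - P) + 1).
have D0 : 0 < c - P + (K - P) + 1 by lra.
have e0 : 0 < e by rewrite divr_gt0 //; lra.
have e1 : e < 1 by rewrite ltr_pdivrMr //; lra.
have ec : (1 - e) * P + e * K < c.
  suff : e * (K - P) < c - P by lra.
  by rewrite /e mulrAC ltr_pdivrMr //; nra.
(* A zero coordinate of [p] must not shrink the minimum [m]; for it, the inequality [(1 - e) v <= u]
   is just [0 <= u]. *)
pose pos (v : R) := if 0 < v then v else 1.
have pos0 v : 0 < pos v by rewrite /pos; case: ifP.
pose w := 1 - x - y - z.
pose m := Num.min (Num.min (pos x) (pos y)) (Num.min (pos z) (pos w)).
have m0 : 0 < m by rewrite !lt_min !pos0.
have [[mx my] [mz mw]] : (m <= pos x /\ m <= pos y) /\ (m <= pos z /\ m <= pos w).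
  by rewrite !ge_min !lexx !orbT.
have key v u : 0 <= v -> 0 <= u -> m <= pos v -> `|u - v| < e * m -> (1 - e) * v <= u.
  move=> v0 u0; rewrite /pos; have [vp mv|vn _ _] := ltP 0 v; last by nra.
  rewrite ltr_norml => /andP[H _].
  have : e * m <= e * v by rewrite ler_pM2l.
  lra.
have em0 : 0 < e * m by exact: mulr_gt0.
(* The fourth barycentric coordinate may change by the sum of the three other changes, hence the
   division by [3]. *)
exists (e * m / 3) => [|[[qx qy] qz]]; first by lra.
move=> q3; have [/= qx0 [qy0 [qz0 qs1]]] := q3.
rewrite !ltr_norml => /andP[? ?] /andP[? ?] /andP[? ?].
have kx : (1 - e) * x <= qx by apply: key => //; rewrite ltr_norml; lra.
have ky : (1 - e) * y <= qy by apply: key => //; rewrite ltr_norml; lra.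
have kz : (1 - e) * z <= qz by apply: key => //; rewrite ltr_norml; lra.
have kw : (1 - e) * w <= 1 - qx - qy - qz.
  by apply: key => //; rewrite ?ltr_norml /w; lra.
(* This point solves [q = (1 - e) p + e r], and [kx], [ky], [kz], [kw] say that its barycentric
   coordinates are nonnegative. *)
have r3 : @std3 R ((qx - (1 - e) * x) / e, (qy - (1 - e) * y) / e, (qz - (1 - e) * z) / e).
  apply: std3P; rewrite -?mulrDl ?ler_pdivlMr ?ler_pdivrMr // ?mul0r ?mul1r; rewrite /w in kw; lra.
have e01 : 0 <= e <= 1 by rewrite !ltW.
have := ch p3 r3 e01; rewrite /= -/P.
have mulK (a b : R) : (1 - e) * a + e * ((b - (1 - e) * a) / e) = b.
  by rewrite mulrC [e * _]mulrC divfK ?gt_eqF //; ring.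
rewrite !mulK => H; apply: le_lt_trans H _; apply: le_lt_trans ec.
by rewrite lerD2l ler_pM2l //; exact: hK.
Qed.

(** By upper semicontinuity, [h < c] defines a relatively open subset of the simplex, hence a
    countable union of traces of rational boxes. *)
Lemma convex_simplex_measurable : measurable_fun (@std3 R) h.
Proof.
apply: (measurability _ (RGenInftyO.measurableE R)) => // _ [_ [c ->]] <-.
pose box (i : rat * rat * rat * rat) : set (R * R * R) :=
  [set q | [/\ `|q.1.1 - ratr i.1.1.1| < ratr i.2, `|q.1.2 - ratr i.1.1.2| < ratr i.2
             & `|q.2 - ratr i.1.2| < ratr i.2]].
pose I := [set i | @std3 R `&` box i `<=` [set q | h q < c]].
have -> : @std3 R `&` h @^-1` `]-oo, c[ = \bigcup_(i in I) (@std3 R `&` box i).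
  apply/seteqP; split => [p [p3 /=]|q [i iI qi]]; last first.
    by split; [case: qi|rewrite /= in_itv /=; exact: iI].
  rewrite in_itv /= => pc.
  have [d d0 hd] := convex_simplex_usc p3 pc.
  (* A box of radius below [d / 2], centered within that radius of [p], stays within [d] of [p]. *)
  have [r] : exists r : rat, ratr r \in `]0, d / 2[.
    by apply: rat_in_itvoo; lra.
  rewrite in_itv /= => /andP[r0 rd].
  have approx (v : R) : exists a : rat, `|v - ratr a| < ratr r.
    have [|a] := @rat_in_itvoo R (v - ratr r) (v + ratr r); first lra.
    by rewrite in_itv /= => /andP[? ?]; exists a; rewrite ltr_norml; lra.
  have [a1 ha1] := approx p.1.1; have [a2 ha2] := approx p.1.2; have [a3 ha3] := approx p.2.
  exists (a1, a2, a3, r); last by [].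
  move=> q [q3 [/= h1 h2 h3]]; apply: hd => //.
  - by move: ha1 h1; rewrite !ltr_norml; lra.
  - by move: ha2 h2; rewrite !ltr_norml; lra.
  - by move: ha3 h3; rewrite !ltr_norml; lra.
rewrite bigcup_mkcond; apply: countable_bigcupT_measurable => [|i]; first exact: countableP.
case: ifP => _; last exact: measurable0.
apply: measurableI; first exact: measurable_std3.
have mball (k : R * R * R -> R) (a r : R) : measurable_fun setT k ->
    measurable [set q | `|k q - a| < r].
  move=> mk; rewrite -(setTI [set q | _]).
  rewrite (_ : [set q | _] = k @^-1` `]a - r, a + r[%classic).
    by apply: mk => //; exact: measurable_itv.
  by apply/seteqP; split => q /=; rewrite in_itv /= ltr_norml; lra.
rewrite (_ : box i = [set q | `|q.1.1 - ratr i.1.1.1| < ratr i.2] `&`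
   ([set q | `|q.1.2 - ratr i.1.1.2| < ratr i.2] `&` [set q | `|q.2 - ratr i.1.2| < ratr i.2])).
  apply: measurableI; [|apply: measurableI].
  - by apply: (mball (fun q => q.1.1)); measurable_poly.
  - by apply: (mball (fun q => q.1.2)); measurable_poly.
  - by apply: (mball (fun q => q.2)); measurable_poly.
by apply/seteqP; split => [q [? ? ?]|q [? [? ?]]]; do ?split.
Qed.

End ConvexOnSimplex.

(** * Averages over a tetrahedron *)

Section Tetrahedron.
Variable R : realType.
Local Notation mu := (@lebesgue_measure R).
Implicit Types (f : pt R -> R) (a b c d : pt R).

Definition bary a b c d (p : R * R * R) : pt R :=
  a + p.1.1 *: (b - a) + p.1.2 *: (c - a) + p.2 *: (d - a).

(* shifted by [N] to be nonnegative, and extended by zero so as to be defined on the whole space *)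
Definition simplex_fun f N a b c d : R * R * R -> R :=
  (fun p => f (bary a b c d p) - N) \_ (@std3 R).

Lemma conv4_bary a b c d p : @std3 R p -> conv4 a b c d (bary a b c d p).
Proof.
case: p => -[x y] z [/= x0 [y0 [z0 s1]]].
exists (1 - x - y - z), x, y, z; split; first by split => //; lra.
by split; [ring|apply/rowP => i; rewrite /bary !mxE /=; ring].
Qed.

Lemma conv4_swap01 a b c d : conv4 a b c d `<=` conv4 b a c d.
Proof.
move=> x [l0 [l1 [l2 [l3 [[? ? ? ?] [s ->]]]]]]; exists l1, l0, l2, l3.
by split=> //; split; [lra|rewrite [l1 *: _ + _]addrC].
Qed.

Lemma conv4_swap12 a b c d : conv4 a b c d `<=` conv4 a c b d.
Proof.
move=> x [l0 [l1 [l2 [l3 [[? ? ? ?] [s ->]]]]]]; exists l0, l2, l1, l3.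
by split=> //; split; [lra|rewrite [l0 *: _ + l2 *: _ + _]addrAC].
Qed.

Lemma conv4_swap23 a b c d : conv4 a b c d `<=` conv4 a b d c.
Proof.
move=> x [l0 [l1 [l2 [l3 [[? ? ? ?] [s ->]]]]]]; exists l0, l1, l3, l2.
by split=> //; split; [lra|rewrite [X in _ = X]addrAC].
Qed.

Lemma convex_on_sub (S T : set (pt R)) f : S `<=` T -> convex_on T f -> convex_on S f.
Proof. by move=> ST cf x y t Sx Sy; apply: cf; exact: ST. Qed.

Lemma convex_on_bary f a b c d : convex_on (conv4 a b c d) f ->
  forall p q t, @std3 R p -> @std3 R q -> 0 <= t <= 1 ->
  f (bary a b c d ((1 - t) * p.1.1 + t * q.1.1, (1 - t) * p.1.2 + t * q.1.2,
     (1 - t) * p.2 + t * q.2))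
  <= (1 - t) * f (bary a b c d p) + t * f (bary a b c d q).
Proof.
move=> cf p q t p3 q3 t01.
have := cf _ _ t (conv4_bary a b c d p3) (conv4_bary a b c d q3) t01.
apply: le_trans; rewrite le_eqVlt; apply/orP; left; apply/eqP; congr f.
by apply/rowP => i; rewrite /bary !mxE /=; ring.
Qed.

(** Supplies the shift [N] that makes the integrands nonnegative, as Tonelli's theorem and the
    substitutions require. *)
Lemma convex_on_lbound f a b c d : convex_on (conv4 a b c d) f ->
  exists N, forall x, conv4 a b c d x -> N <= f x.
Proof.
move=> cf; have [N hN] := convex_simplex_lbound (convex_on_bary cf).
exists N => x [l0 [l1 [l2 [l3 [[? ? ? ?] [s ->]]]]]].
have := hN (l1, l2, l3); rewrite (_ : bary _ _ _ _ _ = l0 *: a + l1 *: b + l2 *: c + l3 *: d).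
  by apply; rewrite /std3 /=; repeat split; lra.
by apply/rowP => i; rewrite /bary !mxE /= (_ : l0 = 1 - l1 - l2 - l3); [ring|lra].
Qed.

Section Averages.
Variables (f : pt R -> R) (a b c d : pt R) (N : R).
Hypothesis cf : convex_on (conv4 a b c d) f.
Hypothesis hN : forall x, conv4 a b c d x -> N <= f x.
Local Notation g := (simplex_fun f N a b c d).

Let gE p : @std3 R p -> g p = f (bary a b c d p) - N.
Proof. by move=> p3; rewrite /simplex_fun patchE mem_set. Qed.

Lemma measurable_simplex_fun : measurable_fun setT g.
Proof.
apply/(measurable_restrictT _ (@measurable_std3 R)).
apply: measurable_funB; last exact: measurable_cst.
exact: (convex_simplex_measurable (convex_on_bary cf)).
Qed.

Lemma simplex_fun_ge0 p : 0 <= g p.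
Proof.
rewrite /simplex_fun patchE; case: ifPn => // /set_mem p3.
by rewrite subr_ge0; apply: hN; exact: conv4_bary.
Qed.

Lemma simplex_fun_supp p : ~ @std3 R p -> g p = 0.
Proof. by move=> np; rewrite /simplex_fun patchE memNset. Qed.

Let bounded : exists M, forall p, g p <= M.
Proof.
have [M hM] := convex_simplex_ubound (convex_on_bary cf).
exists (`|M - N|) => p; rewrite /simplex_fun patchE.
case: ifPn => [/set_mem p3|_]; last exact: normr_ge0.
by apply: le_trans (ler_norm _); rewrite lerD2r; exact: hM.
Qed.

Let cg p q t : @std3 R p -> @std3 R q -> 0 <= t <= 1 ->
  g ((1 - t) * p.1.1 + t * q.1.1, (1 - t) * p.1.2 + t * q.1.2, (1 - t) * p.2 + t * q.2)
  <= (1 - t) * g p + t * g q.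
Proof.
move=> p3 q3 t01; rewrite !gE //; first by have := convex_on_bary cf p3 q3 t01; lra.
move: p3 q3 t01 => [? [? [? ?]]] [? [? [? ?]]] /andP[t0 t1].
have c0 : 0 <= 1 - t by lra.
rewrite /std3 /=; split; [|split; [|split]]; try (by apply: addr_ge0; exact: mulr_ge0).
have := ler_wpM2l t0 (_ : q.1.1 + q.1.2 + q.2 <= 1).
have := ler_wpM2l c0 (_ : p.1.1 + p.1.2 + p.2 <= 1).
by move=> /(_ ltac:(assumption)) ? /(_ ltac:(assumption)) ?; lra.
Qed.

Lemma avg_tetE : avg_tet f a b c d = 6 * Rintegral (@leb3 R) (@std3 R) g + N.
Proof.
have [M gM] := bounded.
have ig : (@leb3 R).-integrable (@std3 R) (EFin \o g).
  apply: (integrable_std3 measurable_simplex_fun) => p.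
  by rewrite ger0_norm //; exact: simplex_fun_ge0.
rewrite /avg_tet (_ : Rintegral _ _ _ = Rintegral (@leb3 R) (@std3 R) (fun p => g p + cst N p)).
  rewrite RintegralD //; last 2 first.
  - exact: measurable_std3.
  - by apply: (@integrable_std3 _ _ `|N|) => //; exact: measurable_cst.
  rewrite Rintegral_cst; last exact: measurable_std3.
  rewrite (_ : fine _ = 1 / 6); first by lra.
  by change (fine (@leb3 R (@std3 R)) = 1 / 6); rewrite leb3_std3.
apply: eq_Rintegral => p; rewrite inE => p3.
by rewrite gE // /cst /= subrK.
Qed.

(** Extension by zero gives an integral over the whole space, to which changes of variables apply
    without tracking domains. *)
Lemma avg_tet_integral :
  avg_tet f a b c d = 6 * fine (\int[@leb3 R]_p (g p)%:E)%E + N.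
Proof.
rewrite avg_tetE /Rintegral; congr (6 * fine _ + N); apply/esym/integral_suppE => p np.
by rewrite simplex_fun_supp.
Qed.

(** [s] locates the triangle in the coordinates of the tetrahedron, so that all averages use the
    same [g] and the same shift [N]. *)
Let avg_tri_shift u v w (s : R * R -> R * R * R) : measurable_fun setT s ->
  (forall q, @std2 R q -> @std3 R (s q) /\
     u + q.1 *: (v - u) + q.2 *: (w - u) = bary a b c d (s q)) ->
  avg_tri f u v w = 2 * Rintegral (@leb2 R) (@std2 R) (fun q => g (s q)) + N.
Proof.
move=> ms hs; have [M gM] := bounded.
have ig : (@leb2 R).-integrable (@std2 R) (EFin \o (fun q => g (s q))).
  apply: (@integrable_std2 _ _ M) => [|p].
    by apply: (measurableT_comp measurable_simplex_fun).
  by rewrite ger0_norm //; exact: simplex_fun_ge0.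
rewrite /avg_tri (_ : Rintegral _ _ _ = Rintegral (@leb2 R) (@std2 R) (fun q => g (s q) + cst N q)).
  rewrite RintegralD //; last 2 first.
  - exact: measurable_std2.
  - by apply: (@integrable_std2 _ _ `|N|) => //; exact: measurable_cst.
  rewrite Rintegral_cst; last exact: measurable_std2.
  rewrite (_ : fine _ = 1 / 2); first by lra.
  by change (fine (@leb2 R (@std2 R)) = 1 / 2); rewrite leb2_std2.
apply: eq_Rintegral => q; rewrite inE => /hs[s3 ->].
by rewrite gE // /cst /= subrK.
Qed.

Let avg_seg_shift u v (s : R -> R * R * R) : measurable_fun setT s ->
  (forall t, @std1 R t -> @std3 R (s t) /\ u + t *: (v - u) = bary a b c d (s t)) ->
  avg_seg f u v = Rintegral mu (@std1 R) (fun t => g (s t)) + N.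
Proof.
move=> ms hs; have [M gM] := bounded.
have ig : mu.-integrable (@std1 R) (EFin \o (fun q => g (s q))).
  apply: (@integrable_std1 _ _ M) => [|p].
    by apply: (measurableT_comp measurable_simplex_fun).
  by rewrite ger0_norm //; exact: simplex_fun_ge0.
rewrite /avg_seg /leb (_ : Rintegral _ _ _ = Rintegral mu (@std1 R) (fun q => g (s q) + cst N q)).
  rewrite RintegralD //; last 2 first.
  - exact: measurable_std1.
  - by apply: (@integrable_std1 _ _ `|N|) => //; exact: measurable_cst.
  rewrite Rintegral_cst; last exact: measurable_std1.
  rewrite (_ : fine _ = 1); first by lra.
  by change (fine (mu (@std1 R)) = 1); rewrite mu_std1.
apply: eq_Rintegral => q; rewrite inE => /hs[s3 ->].
by rewrite gE // /cst /= subrK.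
Qed.

(** The inequalities for [g] transfer to [f] because the coefficients on each side sum to one and
    the shift [N] cancels. *)
Lemma tetrahedron_average_ineqs :
  [/\ avg_tet f a b c d <= f d / 4 + 3 / 4 * avg_tri f a b c,
      avg_tri f (homothety d (3 / 4) a) (homothety d (3 / 4) b) (homothety d (3 / 4) c)
        <= avg_tet f a b c d &
      avg_tet f a b c d <= (avg_seg f a b + avg_seg f c d) / 2].
Proof.
have [M gM] := bounded.
have mg := measurable_simplex_fun; have g0 := simplex_fun_ge0; have sg := simplex_fun_supp.
have d3 : @std3 R (0, 0, 1) by rewrite /std3 /=; repeat split; lra.
have gd : g (0, 0, 1) = f d - N.
  by rewrite gE //; congr (f _ - _); apply/rowP => i; rewrite /bary !mxE /=; ring.
rewrite avg_tetE; split.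
- rewrite (@avg_tri_shift a b c (fun q => (q.1, q.2, 0))); first last.
  + move=> q [q1 [q2 q12]]; split; first by rewrite /std3 /=; repeat split; lra.
    by apply/rowP => i; rewrite /bary !mxE /=; ring.
  + by measurable_poly.
  by have := cone_average_le mg g0 gM sg cg; rewrite gd; lra.
(* In coordinates, the homothety at [d] scales the base by [3 / 4] and raises it to height
   [1 / 4]. *)
- rewrite (@avg_tri_shift _ _ _ (fun q => (3 / 4 * q.1, 3 / 4 * q.2, 1 / 4))); first last.
  + move=> q [q1 [q2 q12]]; split; first by rewrite /std3 /=; repeat split; lra.
    by apply/rowP => i; rewrite /bary /homothety !mxE /=; field.
  + by measurable_poly.
  by have := slice_average_le mg g0 gM sg cg; lra.
- rewrite (@avg_seg_shift a b (fun t => (t, 0, 0))); first last.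
  + move=> t /andP[t0 t1]; split; first by rewrite /std3 /=; repeat split; lra.
    by apply/rowP => i; rewrite /bary !mxE /=; ring.
  + by measurable_poly.
  rewrite (@avg_seg_shift c d (fun t => (0, 1 - t, t))); first last.
  + move=> t /andP[t0 t1]; split; first by rewrite /std3 /=; repeat split; lra.
    by apply/rowP => i; rewrite /bary !mxE /=; ring.
  + by measurable_poly.
  by have := opposite_edges_average_le mg g0 gM sg cg; lra.
Qed.

End Averages.

(** Turns a measure-preserving symmetry [s] of the standard simplex into invariance under a
    reordering of the vertices; one lower bound [N] serves both orders. *)
Lemma avg_tet_reindex f a b c d a' b' c' d' (s : R * R * R -> R * R * R) :
  convex_on (conv4 a b c d) f -> conv4 a' b' c' d' `<=` conv4 a b c d ->
  (forall p, @std3 R (s p) <-> @std3 R p) ->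
  (forall p, bary a' b' c' d' (s p) = bary a b c d p) ->
  (forall G : R * R * R -> \bar R, measurable_fun setT G -> (forall p, (0 <= G p)%E) ->
    (\int[@leb3 R]_p G p = \int[@leb3 R]_p G (s p))%E) ->
  avg_tet f a' b' c' d' = avg_tet f a b c d.
Proof.
move=> cf sub s3 sbary sint; have [N hN] := convex_on_lbound cf.
have cf' := convex_on_sub sub cf.
have hN' x : conv4 a' b' c' d' x -> N <= f x by move=> /sub; exact: hN.
rewrite (avg_tet_integral cf hN) (avg_tet_integral cf' hN').
rewrite (sint (EFin \o simplex_fun f N a' b' c' d')); last 2 first.
- by apply/measurable_EFinP; exact: measurable_simplex_fun.
- by move=> p; rewrite lee_fin; exact: simplex_fun_ge0.
congr (6 * fine _ + N); apply: eq_integral => p _ /=; congr EFin.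
rewrite /simplex_fun !patchE sbary; congr (if _ then _ else _).
by apply/idP/idP; rewrite !inE => /s3.
Qed.

Lemma avg_tet_swap01 f a b c d : convex_on (conv4 a b c d) f ->
  avg_tet f b a c d = avg_tet f a b c d.
Proof.
move=> cf; apply: (avg_tet_reindex (s := fun p => (1 - p.1.1 - p.1.2 - p.2, p.1.2, p.2)) cf).
- exact: conv4_swap01.
- by move=> [[x y] z]; rewrite /std3 /=; split => -[? [? [? ?]]]; repeat split; lra.
- by move=> [[x y] z]; apply/rowP => i; rewrite /bary !mxE /=; ring.
- exact: leb3_reflect.
Qed.

Lemma avg_tet_swap12 f a b c d : convex_on (conv4 a b c d) f ->
  avg_tet f a c b d = avg_tet f a b c d.
Proof.
move=> cf; apply: (avg_tet_reindex (s := fun p => (p.1.2, p.1.1, p.2)) cf).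
- exact: conv4_swap12.
- by move=> [[x y] z]; rewrite /std3 /=; split => -[? [? [? ?]]]; repeat split; lra.
- by move=> [[x y] z]; apply/rowP => i; rewrite /bary !mxE /=; ring.
- exact: leb3_swap12.
Qed.

Lemma avg_tet_swap23 f a b c d : convex_on (conv4 a b c d) f ->
  avg_tet f a b d c = avg_tet f a b c d.
Proof.
move=> cf; apply: (avg_tet_reindex (s := fun p => (p.1.1, p.2, p.1.2)) cf).
- exact: conv4_swap23.
- by move=> [[x y] z]; rewrite /std3 /=; split => -[? [? [? ?]]]; repeat split; lra.
- by move=> [[x y] z]; apply/rowP => i; rewrite /bary !mxE /=; ring.
- exact: leb3_swap23.
Qed.

(** The basic inequalities single out the last vertex and the first and last pairs of vertices. Five
    orders of the vertices yield the two apexes and the three pairs of opposite edges. *)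
Lemma tetrahedron_ineqs f o p a b : convex_on (conv4 o p a b) f ->
  [/\ avg_tet f o p a b <= f o / 4 + 3 / 4 * avg_tri f p a b,
      avg_tri f (homothety o (3 / 4) p) (homothety o (3 / 4) a) (homothety o (3 / 4) b)
        <= avg_tet f o p a b,
      avg_tet f o p a b <= f p / 4 + 3 / 4 * avg_tri f o a b &
      avg_tri f (homothety p (3 / 4) o) (homothety p (3 / 4) a) (homothety p (3 / 4) b)
        <= avg_tet f o p a b] /\
  [/\ avg_tet f o p a b <= (avg_seg f o p + avg_seg f a b) / 2,
      avg_tet f o p a b <= (avg_seg f o a + avg_seg f p b) / 2 &
      avg_tet f o p a b <= (avg_seg f p a + avg_seg f o b) / 2].
Proof.
move=> c_opab.
have c_poab := convex_on_sub (@conv4_swap01 _ _ _ _) c_opab.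
have c_oapb := convex_on_sub (@conv4_swap12 _ _ _ _) c_opab.
have c_paob := convex_on_sub (@conv4_swap12 _ _ _ _) c_poab.
have c_oabp := convex_on_sub (@conv4_swap23 _ _ _ _) c_oapb.
have c_pabo := convex_on_sub (@conv4_swap23 _ _ _ _) c_paob.
have e_poab := avg_tet_swap01 c_opab.
have e_oapb := avg_tet_swap12 c_opab.
have e_paob := etrans (avg_tet_swap12 c_poab) e_poab.
have e_oabp := etrans (avg_tet_swap23 c_oapb) e_oapb.
have e_pabo := etrans (avg_tet_swap23 c_paob) e_paob.
have ineqs x y z w (cf : convex_on (conv4 x y z w) f) :=
  let: ex_intro N hN := convex_on_lbound cf in tetrahedron_average_ineqs cf hN.
have [i1 i2 _] := ineqs _ _ _ _ c_pabo; have [i3 i4 _] := ineqs _ _ _ _ c_oabp.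
have [_ _ i5] := ineqs _ _ _ _ c_opab; have [_ _ i6] := ineqs _ _ _ _ c_oapb.
have [_ _ i7] := ineqs _ _ _ _ c_paob.
rewrite e_pabo in i1 i2; rewrite e_oabp in i3 i4; rewrite e_oapb in i6; rewrite e_paob in i7.
by split; split; [exact: i1|exact: i2|exact: i3|exact: i4|exact: i5|exact: i6|exact: i7].
Qed.

End Tetrahedron.

(** * Weights *)

Lemma det_mx33 (R : comNzRingType) (A : 'M[R]_3) : \det A =
  A 0 0 * (A 1 1 * A 2 2 - A 1 2 * A 2 1)
  - A 0 1 * (A 1 0 * A 2 2 - A 1 2 * A 2 0)
  + A 0 2 * (A 1 0 * A 2 1 - A 1 1 * A 2 0).
Proof.
(* Indexing by natural numbers identifies the different terms denoting the same element of
   ['I_3]. *)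
pose B (i j : nat) := A (inord i) (inord j).
have AB i j : A i j = B i j by rewrite /B !inord_val.
rewrite (expand_det_row _ ord0) !big_ord_recl big_ord0 addr0 /cofactor.
rewrite !(expand_det_row _ ord0) !big_ord_recl !big_ord0 /cofactor !det_mx11 !mxE /=.
rewrite !AB /= /bump /= ?addnE /=.
ring.
Qed.

(** * Dot products and Gram determinants *)

Section Gram.
Variable R : realType.
Implicit Types u v w : pt R.

Lemma dotpE u v : dotp u v = u 0 0 * v 0 0 + u 0 1 * v 0 1 + u 0 2 * v 0 2.
Proof.
rewrite /dotp mxE !big_ord_recl big_ord0 addr0 addrA !mxE.
by congr (_ * _ + _ * _ + _ * _); congr (_ 0 _); apply/val_inj.
Qed.

Lemma dotpC u v : dotp u v = dotp v u.
Proof. by rewrite !dotpE; ring. Qed.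

Lemma dotpDl u v w : dotp (u + v) w = dotp u w + dotp v w.
Proof. by rewrite !dotpE !mxE; ring. Qed.

Lemma dotpZl (k : R) u v : dotp (k *: u) v = k * dotp u v.
Proof. by rewrite !dotpE !mxE; ring. Qed.

Lemma dotpDr u v w : dotp u (v + w) = dotp u v + dotp u w.
Proof. by rewrite dotpC dotpDl !(dotpC u). Qed.

Lemma dotpZr (k : R) u v : dotp u (k *: v) = k * dotp u v.
Proof. by rewrite dotpC dotpZl (dotpC u). Qed.

Lemma dotp_ge0 u : 0 <= dotp u u.
Proof. by rewrite dotpE !addr_ge0 // -expr2 sqr_ge0. Qed.

Lemma dotp_gt0 u : u != 0 -> 0 < dotp u u.
Proof.
move=> u0; rewrite lt_neqAle dotp_ge0 andbT; apply: contra u0 => /eqP.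
rewrite dotpE -!expr2 => /esym/eqP.
rewrite !paddr_eq0 ?addr_ge0 ?sqr_ge0 // !sqrf_eq0 => /andP[/andP[/eqP x0 /eqP x1] /eqP x2].
apply/eqP/rowP => i; rewrite mxE.
have : i \in [:: 0; 1; 2] by case: i => -[|[|[|]]].
by rewrite !inE => /or3P[] /eqP ->.
Qed.

(** Expand the squared norm of [(u . u) v - (u . v) u]. *)
Lemma dotp_cauchy_schwarz u v : dotp u v ^+ 2 <= dotp u u * dotp v v.
Proof.
have [->|/dotp_gt0 u0] := eqVneq u 0; first by rewrite !dotpE !mxE !mul0r !addr0 expr0n mul0r.
have := dotp_ge0 (dotp u u *: v + (- dotp u v) *: u).
rewrite !(dotpDl, dotpDr, dotpZl, dotpZr) (dotpC v u).
rewrite (_ : _ + _ = dotp u u * (dotp u u * dotp v v - dotp u v ^+ 2)); last by ring.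
by rewrite pmulr_rge0 // subr_ge0.
Qed.

(** The Gram determinant expresses squared volumes through dot products, which for the polygon do
    not depend on [k]. *)
Lemma det_gram u v w : \det (col_mx u (col_mx v w)) ^+ 2 =
  dotp u u * (dotp v v * dotp w w - dotp v w ^+ 2)
  - dotp u v * (dotp u v * dotp w w - dotp v w * dotp u w)
  + dotp u w * (dotp u v * dotp v w - dotp v v * dotp u w).
Proof.
set A : 'M[R]_3 := col_mx u _.
have A0 j : A 0 j = u 0 j.
  rewrite -(col_mxEu u (col_mx v w)); apply: (congr1 (fun i : 'I_3 => A i j)); exact: val_inj.
have A1 j : A 1 j = v 0 j.
  rewrite -(col_mxEu v w) -(col_mxEd u (col_mx v w)).
  apply: (congr1 (fun i : 'I_3 => A i j)); exact: val_inj.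
have A2 j : A 2 j = w 0 j.
  rewrite -(col_mxEd v w) -(col_mxEd u (col_mx v w)).
  apply: (congr1 (fun i : 'I_3 => A i j)); exact: val_inj.
rewrite det_mx33 !A0 !A1 !A2 !dotpE; ring.
Qed.

End Gram.

(** * Equal weights, cyclic sums and the central angle *)

Lemma wavg_const (R : realType) n (w av : nat -> R) (W : R) : (0 < n)%N -> 0 < W ->
  (forall k, w k = W) -> wavg n w av = (\sum_(k < n) av k) / n%:R.
Proof.
move=> n0 W0 wW; rewrite /wavg.
under eq_bigr do rewrite wW; under [X in _ / X]eq_bigr do rewrite wW.
rewrite -mulr_sumr sumr_const card_ord -[W *+ n]mulr_natr.
by rewrite -mulf_div divff ?mul1r // gt_eqF.
Qed.

Lemma sum_cyclic (R : realType) n (u : nat -> R) : u n = u 0%N ->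
  \sum_(k < n) u k.+1 = \sum_(k < n) u k.
Proof.
case: n => [|n] un; first by rewrite !big_ord0.
by rewrite big_ord_recr /= un big_ord_recl /= addrC.
Qed.

(** Here [u] and [v] stand for the edges from the two apexes. After averaging the two crossed
    bounds, the index shifts disappear in the cyclic sums. *)
Lemma sum_crossed_le (R : realType) n (t u v : nat -> R) : u n = u 0%N -> v n = v 0%N ->
  (forall k, (k < n)%N -> t k <= (u k + v k.+1) / 2) ->
  (forall k, (k < n)%N -> t k <= (v k + u k.+1) / 2) ->
  \sum_(k < n) t k <= (\sum_(k < n) u k + \sum_(k < n) v k) / 2.
Proof.
move=> un vn tu tv.
have -> : (\sum_(k < n) u k + \sum_(k < n) v k) / 2 =
    \sum_(k < n) ((u k + v k.+1) / 2 + (v k + u k.+1) / 2) / 2.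
  by rewrite -mulr_suml big_split -!mulr_suml !big_split /= !sum_cyclic //; field.
by apply: ler_sum => k _; have := tu k (ltn_ord k); have := tv k (ltn_ord k); lra.
Qed.

(** From three vertices on, the central angle lies strictly between [0] and [pi]; this is what makes
    the weights nonzero. *)
Lemma cos_sq_lt1 (R : realType) n : (3 <= n)%N -> cos (2 * pi / n%:R : R) ^+ 2 < 1.
Proof.
move=> n3; rewrite cos2sin2 gtrBl exprn_gt0 // sin_gt0_pi //.
have n0 : 0 < n%:R :> R by rewrite ltr0n; apply: leq_trans n3.
have p0 := pi_gt0 R.
rewrite divr_gt0 ?mulr_gt0 //= ltr_pdivrMr // mulrC ltr_pM2l //.
by rewrite ltr_nat.
Qed.

(** * Lengths, areas and volumes for a regular polygon and points of its axis *)

Section RegularPolygon.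
Variables (R : realType) (n : nat) (C e1 e2 : pt R) (r th0 : R) (A : nat -> pt R).
Hypotheses (n3 : (3 <= n)%N) (e11 : dotp e1 e1 = 1) (e22 : dotp e2 e2 = 1).
Hypotheses (e12 : dotp e1 e2 = 0) (r0 : 0 < r).
Hypothesis AE : forall k, A k = reg_vertex n C e1 e2 r th0 k.

Let n0 : n%:R != 0 :> R. Proof. by rewrite pnatr_eq0 -lt0n (leq_trans _ n3). Qed.
Let c : R := cos (2 * pi / n%:R).

Let c1 : 0 < 1 - c /\ 0 < 1 + c.
Proof. by have := cos_sq_lt1 R n3; rewrite -/c => c2; split; nra. Qed.

Lemma reg_vertex_period : A n = A 0%N.
Proof.
rewrite !AE /reg_vertex mulfK // mulr0 mul0r addr0.
by rewrite [2 * pi]mulrC mulr_natr cosD2pi sinD2pi.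
Qed.

Section Axis.
Variable X : pt R.
Hypotheses (X1 : dotp (X - C) e1 = 0) (X2 : dotp (X - C) e2 = 0).
Let h2 := dotp (C - X) (C - X).
Let th (k : nat) : R := th0 + 2 * pi * k%:R / n%:R.

Let AX k : A k - X = (C - X) + (r * cos (th k)) *: e1 + (r * sin (th k)) *: e2.
Proof. by apply/rowP => i; rewrite AE !mxE -/(th k); ring. Qed.

Let CX1 : dotp (C - X) e1 = 0.
Proof. by rewrite -opprB -scaleN1r dotpZl X1 mulr0. Qed.

Let CX2 : dotp (C - X) e2 = 0.
Proof. by rewrite -opprB -scaleN1r dotpZl X2 mulr0. Qed.

Lemma dotp_axis_vertex u k : dotp u e1 = 0 -> dotp u e2 = 0 ->
  dotp u (A k - X) = dotp u (C - X).
Proof. by move=> u1 u2; rewrite AX !dotpDr !dotpZr u1 u2 !mulr0 !addr0. Qed.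

(** [C - X] is orthogonal to the orthonormal pair [e1], [e2], so only the difference of the angles
    survives. *)
Let dotp_vertices i j : dotp (A i - X) (A j - X) = h2 + r ^+ 2 * cos (th i - th j).
Proof.
rewrite cosB !AX /h2; move: (C - X) CX1 CX2 => q q1 q2.
rewrite !(dotpDl, dotpDr, dotpZl, dotpZr) (dotpC e1 q) (dotpC e2 q) (dotpC e2 e1).
by rewrite q1 q2 e11 e22 e12; ring.
Qed.

Lemma dotp_vertex k : dotp (A k - X) (A k - X) = h2 + r ^+ 2.
Proof. by rewrite dotp_vertices subrr cos0 mulr1. Qed.

Lemma dotp_next_vertex k : dotp (A k - X) (A k.+1 - X) = h2 + r ^+ 2 * c.
Proof.
rewrite dotp_vertices -cosN opprB; congr (_ + _ * cos _).
by rewrite /th -natr1; field.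
Qed.

Let h2_ge0 : 0 <= h2. Proof. exact: dotp_ge0. Qed.

Lemma seg_len_axis : exists2 W, 0 < W & forall k, seg_len X (A k) = W.
Proof.
exists (Num.sqrt (h2 + r ^+ 2)); last by move=> k; rewrite /seg_len /vlen dotp_vertex.
by rewrite sqrtr_gt0 ltr_wpDl // exprn_gt0.
Qed.

Lemma seg_len_side : exists2 W, 0 < W & forall k, seg_len (A k) (A k.+1) = W.
Proof.
exists (Num.sqrt (2 * (r ^+ 2 * (1 - c)))).
  by rewrite sqrtr_gt0 !mulr_gt0 // ?exprn_gt0 //; case: c1.
move=> k; rewrite /seg_len /vlen; congr Num.sqrt.
rewrite (_ : A k.+1 - A k = (A k.+1 - X) + (-1) *: (A k - X)); last first.
  by apply/rowP => i; rewrite !mxE; ring.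
move: (dotp_vertex k) (dotp_vertex k.+1) (dotp_next_vertex k).
move: (A k - X) (A k.+1 - X) => v w vv ww vw.
by rewrite !(dotpDl, dotpDr, dotpZl, dotpZr) (dotpC w v) vv ww vw; ring.
Qed.

(** The Gram determinant of two successive vertices seen from [X] factors as a difference of
    squares, positive because [c] is strictly between [-1] and [1]. The condition on [g] covers the
    identity and homotheties. *)
Lemma tri_area_axis (g : pt R -> pt R) (lam : R) : 0 < lam ->
  (forall x y, g x - g y = lam *: (x - y)) ->
  exists2 W, 0 < W & forall k, tri_area (g X) (g (A k)) (g (A k.+1)) = W.
Proof.
move=> l0 gE.
exists (Num.sqrt (lam ^+ 4 * (r ^+ 2 * (1 - c) * (2 * h2 + r ^+ 2 * (1 + c)))) / 2).
  have [cm cp] := c1; have r2 : 0 < r ^+ 2 by rewrite exprn_gt0.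
  rewrite divr_gt0 // sqrtr_gt0 !mulr_gt0 ?exprn_gt0 //.
  by rewrite ltr_wpDl ?mulr_ge0 // mulr_gt0.
move=> k; rewrite /tri_area; congr (Num.sqrt _ / 2).
rewrite !gE !(dotpZl, dotpZr) !dotp_vertex dotp_next_vertex; ring.
Qed.

(** [Y - X] has the same dot product [s] with all vectors [A k - X], so the Gram determinant
    factors. In the second factor one term is positive since [X != Y], the other is nonnegative by
    Cauchy-Schwarz. *)
Lemma tet_vol_axis (Y : pt R) : dotp (Y - C) e1 = 0 -> dotp (Y - C) e2 = 0 -> X != Y ->
  exists2 W, 0 < W & forall k, tet_vol X Y (A k) (A k.+1) = W.
Proof.
move=> Y1 Y2 XY.
pose w := Y - X; pose s := dotp w (C - X).
have w0 : 0 < dotp w w by apply: dotp_gt0; rewrite subr_eq0 eq_sym.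
have wE : w = (Y - C) + (-1) *: (X - C) by apply/rowP => i; rewrite /w !mxE; ring.
have we1 : dotp w e1 = 0 by rewrite wE dotpDl dotpZl X1 Y1 mulr0 addr0.
have we2 : dotp w e2 = 0 by rewrite wE dotpDl dotpZl X2 Y2 mulr0 addr0.
have cs : s ^+ 2 <= dotp w w * h2 by exact: dotp_cauchy_schwarz.
have [cm cp] := c1; have r2 : 0 < r ^+ 2 by rewrite exprn_gt0.
exists (Num.sqrt (r ^+ 2 * (1 - c) *
    (dotp w w * (r ^+ 2 * (1 + c)) + 2 * (dotp w w * h2 - s ^+ 2))) / 6).
  rewrite divr_gt0 // sqrtr_gt0 mulr_gt0 ?mulr_gt0 // ltr_pwDl ?mulr_gt0 //.
  by rewrite mulr_ge0 // subr_ge0.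
move=> k; rewrite /tet_vol -sqrtr_sqr; congr (Num.sqrt _ / 6).
rewrite det_gram -/w !(dotp_axis_vertex _ we1 we2) !dotp_vertex dotp_next_vertex -/s; ring.
Qed.

End Axis.

End RegularPolygon.

(** * Summation over the simplices of the dipyramid *)

Theorem theorem7p1 (R : realType) (n : nat) (C e1 e2 : pt R) (r th0 : R)
  (A : nat -> pt R) (O0 O1 : pt R) (f : pt R -> R) :
  (3 <= n)%N ->
  dotp e1 e1 = 1 -> dotp e2 e2 = 1 -> dotp e1 e2 = 0 -> 0 < r ->
  (forall k, A k = reg_vertex n C e1 e2 r th0 k) ->
  (* O0, O1 lie on the axis l of P, outside the plane of P, and are distinct *)
  dotp (O0 - C) e1 = 0 -> dotp (O0 - C) e2 = 0 -> O0 != C ->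
  dotp (O1 - C) e1 = 0 -> dotp (O1 - C) e2 = 0 -> O1 != C ->
  O0 != O1 ->
  (forall k, (k < n)%N -> convex_on (conv4 O0 O1 (A k) (A k.+1)) f) ->
  let AvgD := avg_dipyramid f n A O0 O1 in
  [/\ AvgD <= f O0 / 4 + 3 / 4 * avg_umbrella f n A O1,
      AvgD <= f O1 / 4 + 3 / 4 * avg_umbrella f n A O0,
      avg_umbrella_img (homothety O0 (3 / 4)) f n A O1 <= AvgD,
      avg_umbrella_img (homothety O1 (3 / 4)) f n A O0 <= AvgD &
      AvgD <= (avg_seg f O0 O1 + avg_boundary f n A) / 2 /\
      AvgD <= (avg_scaffold f n A O0 + avg_scaffold f n A O1) / 2].
Proof.
move=> n3 e11 e22 e12 r0 AE p01 p02 _ p11 p12 _ O01 cf AvgD.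
have n_gt0 : (0 < n)%N by exact: leq_trans n3.
have N0 : 0 < n%:R :> R by rewrite ltr0n.
have per := reg_vertex_period n3 AE.
have [Wd Wd0 WdE] := tet_vol_axis n3 e11 e22 e12 r0 AE p01 p02 p11 p12 O01.
have [Wb Wb0 WbE] := seg_len_side n3 e11 e22 e12 r0 AE p01 p02.
have [W0 W00 W0E] := seg_len_axis e11 e22 e12 r0 AE p01 p02.
have [W1 W10 W1E] := seg_len_axis e11 e22 e12 r0 AE p11 p12.
have idE (x y : pt R) : id x - id y = 1 *: (x - y) by rewrite scale1r.
have homE X (x y : pt R) : homothety X (3 / 4) x - homothety X (3 / 4) y = (3 / 4) *: (x - y).
  by apply/rowP => i; rewrite !mxE; ring.
have q34 : 0 < (3 / 4 : R) by lra.
have umbrella (g : pt R -> pt R) lam X : 0 < lam ->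
    (forall x y, g x - g y = lam *: (x - y)) ->
    dotp (X - C) e1 = 0 -> dotp (X - C) e2 = 0 ->
    avg_umbrella_img g f n A X =
    (\sum_(k < n) avg_tri f (g X) (g (A k)) (g (A k.+1))) / n%:R.
  move=> l0 gE x1 x2.
  have [W Wp WE] := tri_area_axis n3 e11 e22 e12 r0 AE x1 x2 l0 gE.
  exact: wavg_const WE.
have AvgDE : AvgD = (\sum_(k < n) avg_tet f O0 O1 (A k) (A k.+1)) / n%:R.
  exact: wavg_const WdE.
(* [x] is the contribution common to all simplices: that of an apex or of the segment [O0 O1]. *)
have mean_le (u v : nat -> R) x y : (forall k, (k < n)%N -> u k <= x + y * v k) ->
    (\sum_(k < n) u k) / n%:R <= x + y * ((\sum_(k < n) v k) / n%:R).
  move=> uv; rewrite ler_pdivrMr //.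
  have -> : (x + y * ((\sum_(k < n) v k) / n%:R)) * n%:R = \sum_(k < n) (x + y * v k).
    rewrite big_split /= sumr_const card_ord -mulr_sumr -[x *+ n]mulr_natr.
    by field; rewrite gt_eqF.
  by apply: ler_sum => k _; exact: uv.
have ineqs k (kn : (k < n)%N) := tetrahedron_ineqs (cf k kn).
pose tet k := avg_tet f O0 O1 (A k) (A k.+1).
split; rewrite ?AvgDE.
- rewrite /avg_umbrella (umbrella id 1) //.
  by apply: (mean_le tet (fun k => avg_tri f O1 (A k) (A k.+1))) => k /ineqs [[]].
- rewrite /avg_umbrella (umbrella id 1) //.
  by apply: (mean_le tet (fun k => avg_tri f O0 (A k) (A k.+1))) => k /ineqs [[]].
- rewrite (umbrella _ (3 / 4)) // ler_pM2r ?invr_gt0 //.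
  by apply: ler_sum => k _; have [[_ i _ _] _] := ineqs k (ltn_ord k).
- rewrite (umbrella _ (3 / 4)) // ler_pM2r ?invr_gt0 //.
  by apply: ler_sum => k _; have [[_ _ _ i] _] := ineqs k (ltn_ord k).
split.
- rewrite /avg_boundary (wavg_const _ n_gt0 Wb0 WbE).
  rewrite mulrDl [X in _ + X]mulrC.
  apply: (mean_le tet (fun k => avg_seg f (A k) (A k.+1))) => k /ineqs [_ [i _ _]].
  by apply: le_trans i _; lra.
rewrite /avg_scaffold (wavg_const _ n_gt0 W00 W0E) (wavg_const _ n_gt0 W10 W1E).
rewrite -mulrDl mulrAC ler_pM2r ?invr_gt0 //.
(* The opposite edges [O0 A_k], [O1 A_(k+1)] and [O1 A_k], [O0 A_(k+1)] give the two crossed bounds,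
   and [A n = A 0] closes the cycle. *)
by apply: (sum_crossed_le (t := tet) (u := fun k => avg_seg f O0 (A k))
  (v := fun k => avg_seg f O1 (A k))) => [||k /ineqs [_ [_ i _]]|k /ineqs [_ [_ _ i]]];
  [rewrite per|rewrite per|exact: i|exact: i].
Qed.
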